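(* Let $\mathfrak{C}\prec\mathfrak{C}'$ be models of a complete first-order theory $T$, both at least $(\aleph_0+\lambda)^+$-saturated and strongly $(\aleph_0+\lambda)^+$-homogeneous, and let $X$ be a $\emptyset$-type-definable subset of $\mathfrak{C}^\lambda$. Then $F'_{\mathrm{WAP}}$ and $F_{\mathrm{WAP}}$ are compatible, i.e. $r[F'_{\mathrm{WAP}}]=F_{\mathrm{WAP}}$ where $r:S_X(\mathfrak{C}')\to S_X(\mathfrak{C})$ is the restriction map.
   Context: $S_X(\mathfrak{C})$ is the space of complete types over $\mathfrak{C}$ extending the type defining $X$, a flow under $\mathrm{Aut}(\mathfrak{C})$ (pointwise convergence topology). For a flow $(G,Y)$ and $f\in C(Y)$ (continuous real functions), put $(gf)(y)=f(g^{-1}y)$; $f$ is WAP (weakly almost periodic) if $\{gf:g\in G\}$ is relatively compact in the weak topology of the Banach space $C(Y)$ (sup norm); the flow is WAP if every $f\in C(Y)$ is WAP. $F_{\mathrm{WAP}}$ is the finest closed $\mathrm{Aut}(\mathfrak{C})$-invariant equivalence relation on $S_X(\mathfrak{C})$ such that the quotient flow $(\mathrm{Aut}(\mathfrak{C}),S_X(\mathfrak{C})/F_{\mathrm{WAP}})$ is WAP (it exists); $F'_{\mathrm{WAP}}$ is the analogous relation on $S_X(\mathfrak{C}')$ for $\mathrm{Aut}(\mathfrak{C}')$. $r[F']=\{(r(a),r(b)):(a,b)\in F'\}$. *)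

(* Defs.v *)
From HB Require Import structures.
From mathcomp Require Import all_boot all_order all_algebra finmap.
From mathcomp Require Import all_classical all_reals all_analysis.

Set Implicit Arguments.
Unset Strict Implicit.
Unset Printing Implicit Defensive.

Import Order.TTheory GRing.Theory Num.Theory.
Import numFieldNormedType.Exports.

Local Open Scope classical_set_scope.
Local Open Scope ring_scope.
Local Open Scope card_scope.

Record language := Language {
  fsym : Type;
  farity : fsym -> nat;
  rsym : Type;
  rarity : rsym -> nat }.

Inductive term (L : language) (V : Type) : Type :=
| Var of V
| App (f : fsym L) of ('I_(farity f) -> term L V).

(* [formula L V] is the type of first-order formulas whose free variables lie
   in V; a quantifier binds the variable [None] of a formula over [option V].
   L(A)-formulas in the variables V are [formula L (V + A)], and
   L(A)-sentences are [formula L A]. *)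
Inductive formula (L : language) (V : Type) : Type :=
| Eq of term L V & term L V
| Rel (r : rsym L) of ('I_(rarity r) -> term L V)
| Bot
| Imp of formula L V & formula L V
| All of formula L (option V).

Arguments Bot {L V}.

Definition Neg (L : language) (V : Type) (phi : formula L V) := Imp phi Bot.

HB.instance Definition _ (L : language) (V : Type) :=
  gen_eqMixin (formula L V).
HB.instance Definition _ (L : language) (V : Type) :=
  gen_choiceMixin (formula L V).
HB.instance Definition _ (L : language) (V : Type) :=
  isPointed.Build (formula L V) Bot.

Definition sentence (L : language) := formula L void.

Fixpoint trename (L : language) (V W : Type) (h : V -> W) (t : term L V)
    : term L W :=
  match t with
  | Var v => Var L (h v)
  | App f ts => App (fun i => trename h (ts i))
  end.

Fixpoint rename (L : language) (V W : Type) (h : V -> W) (phi : formula L V)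
    {struct phi} : formula L W :=
  match phi with
  | Eq t u => Eq (trename h t) (trename h u)
  | Rel r ts => Rel (fun i => trename h (ts i))
  | Bot => Bot
  | Imp phi psi => Imp (rename h phi) (rename h psi)
  | All phi => All (rename (omap h) phi)
  end.

Record structure (L : language) := Structure {
  carrier :> Type;
  carrier_inhabited : inhabited carrier;
  fint : forall f : fsym L, ('I_(farity f) -> carrier) -> carrier;
  rint : forall r : rsym L, ('I_(rarity r) -> carrier) -> Prop }.

Section semantics.
Context (L : language) (M : structure L).

Fixpoint eval (V : Type) (v : V -> M) (t : term L V) : M :=
  match t with
  | Var x => v x
  | App f ts => fint (fun i => eval v (ts i))
  end.

Definition scons (V : Type) (x : M) (v : V -> M) : option V -> M :=
  fun o => if o is Some y then v y else x.

Fixpoint sat (V : Type) (v : V -> M) (phi : formula L V) {struct phi} : Prop :=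
  match phi with
  | Eq t u => eval v t = eval v u
  | Rel r ts => rint (fun i => eval v (ts i))
  | Bot => False
  | Imp phi psi => sat v phi -> sat v psi
  | All phi => forall x : M, sat (scons x v) phi
  end.

End semantics.

Definition assign (V P T : Type) (a : V -> T) (c : P -> T) (x : V + P) : T :=
  match x with inl i => a i | inr b => c b end.

Definition models (L : language) (M : structure L) (T : set (sentence L)) :=
  forall phi, T phi -> sat (of_void M) phi.

Definition entails (L : language) (T : set (sentence L)) (phi : sentence L) :=
  forall M : structure L, models M T -> sat (of_void M) phi.

Definition complete_theory (L : language) (T : set (sentence L)) :=
  (exists M : structure L, models M T) /\
  forall phi, entails T phi \/ entails T (Neg phi).

Definition elementary (L : language) (M N : structure L) (j : M -> N) :=
  forall phi : formula L M, sat (fun c : M => c) phi <-> sat j phi.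

(* A set p of formulas in the variables V with parameters named by P (via c)
   is finitely satisfiable in M. *)
Definition finsat (L : language) (M : structure L) (V P : Type) (c : P -> M)
    (p : set (formula L (V + P))) :=
  forall q, finite_set q -> q `<=` p ->
    exists a : V -> M, q `<=` [set phi | sat (assign a c) phi].

(* |K|^+-saturation: 1-types over parameter sets A with |A| <= |K|, i.e. of
   cardinality < |K|^+, are realized. *)
Definition succ_saturated (L : language) (M : structure L) (K : Type) :=
  forall A : set M, A #<= [set: K] ->
  forall p : set (formula L (unit + set_type A)),
    finsat (fun c : set_type A => val c) p ->
    exists b : M,
      p `<=` [set phi | sat (assign (fun=> b) (fun c : set_type A => val c)) phi].

Record aut (L : language) (M : structure L) := Aut {
  aut_fun :> M -> M;
  aut_inv : M -> M;
  aut_funK : cancel aut_fun aut_inv;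
  aut_invK : cancel aut_inv aut_fun;
  aut_fint : forall f (x : 'I_(farity f) -> M),
    aut_fun (fint x) = fint (fun i => aut_fun (x i));
  aut_rint : forall r (x : 'I_(rarity r) -> M),
    rint (fun i => aut_fun (x i)) <-> rint x }.

(* Strong |K|^+-homogeneity: every partial elementary map between subsets of
   M, with domain A of cardinality < |K|^+, extends to an automorphism. *)
Definition succ_strongly_homogeneous (L : language) (M : structure L)
    (K : Type) :=
  forall A : set M, A #<= [set: K] ->
  forall f : set_type A -> M,
    (forall phi : formula L (set_type A),
       sat (fun c : set_type A => val c) phi <-> sat f phi) ->
    exists g : aut M, forall c : set_type A, g (val c) = f c.

Section aut_group.
Context (L : language) (M : structure L).
Implicit Types g h : aut M.

Lemma aut_eq g h : (forall x, g x = h x) -> g = h.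
Proof.
case: g h => [g g' gK g'K gf gr] [h h' hK h'K hf hr] /= gh.
have {}gh : g = h by apply/funext.
subst h; have gh' : g' = h'.
  by apply/funext => x; apply: (can_inj gK); rewrite g'K h'K.
by subst h'; congr Aut; exact: Prop_irrelevance.
Qed.

Definition aut_id : aut M.
Proof. by exists id id. Defined.

Definition aut_mul g h : aut M.
Proof.
exists (fun x => g (h x)) (fun x => aut_inv h (aut_inv g x)).
- by move=> x; rewrite !aut_funK.
- by move=> x; rewrite !aut_invK.
- by move=> f x; rewrite !aut_fint.
- by move=> r x; rewrite !aut_rint.
Defined.

Definition aut_opp g : aut M.
Proof.
exists (aut_inv g) g.
- exact: aut_invK.
- exact: aut_funK.
- move=> f x; apply: (can_inj (aut_funK g)); rewrite aut_invK aut_fint.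
  by congr fint; apply/funext => i; rewrite aut_invK.
- move=> r x; rewrite -(aut_rint g).
  by under eq_fun do rewrite aut_invK.
Defined.

Lemma aut_mulA : associative aut_mul. Proof. by move=> f g h; exact: aut_eq. Qed.
Lemma aut_mul1 : left_id aut_id aut_mul. Proof. by move=> f; exact: aut_eq. Qed.
Lemma aut_mulr1 : right_id aut_id aut_mul. Proof. by move=> f; exact: aut_eq. Qed.
Lemma aut_mulV : left_inverse aut_id aut_opp aut_mul.
Proof. by move=> f; apply: aut_eq => x /=; rewrite aut_funK. Qed.
Lemma aut_mulrV : right_inverse aut_id aut_opp aut_mul.
Proof. by move=> f; apply: aut_eq => x /=; rewrite aut_invK. Qed.

HB.instance Definition _ := gen_eqMixin (aut M).
HB.instance Definition _ := gen_choiceMixin (aut M).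
HB.instance Definition _ := isGroup.Build (aut M)
  aut_mulA aut_mul1 aut_mulr1 aut_mulV aut_mulrV.

End aut_group.

Section sat_facts.
Context (L : language).

Lemma trename_id (V : Type) (t : term L V) : trename id t = t.
Proof. by elim: t => //= f ts IH; congr App; apply/funext. Qed.

Lemma trename_comp (V W Z : Type) (h : V -> W) (k : W -> Z) (t : term L V) :
  trename k (trename h t) = trename (k \o h) t.
Proof. by elim: t => //= f ts IH; congr App; apply/funext. Qed.

Lemma rename_id (V : Type) (phi : formula L V) : rename id phi = phi.
Proof.
elim: phi => //= {V} [V t u|V r ts|V phi -> psi -> //|V phi IH].
- by rewrite !trename_id.
- by congr Rel; apply/funext => i; rewrite trename_id.
- by rewrite (_ : omap id = id) ?IH//; apply/funext => -[].
Qed.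

Lemma rename_comp (V W Z : Type) (h : V -> W) (k : W -> Z) (phi : formula L V) :
  rename k (rename h phi) = rename (k \o h) phi.
Proof.
elim: phi W Z h k => //= {V} [V t u|V r ts|V phi IH psi IH'|V phi IH] W Z h k.
- by rewrite !trename_comp.
- by congr Rel; apply/funext => i; rewrite trename_comp.
- by rewrite IH IH'.
- by rewrite IH; congr All; congr rename; apply/funext => -[].
Qed.

Lemma eval_rename (M : structure L) (V W : Type) (h : V -> W) (v : W -> M)
  (t : term L V) : eval v (trename h t) = eval (v \o h) t.
Proof. by elim: t => //= f ts IH; congr fint; apply/funext. Qed.

Lemma sat_rename (M : structure L) (V W : Type) (h : V -> W) (v : W -> M)
  (phi : formula L V) : sat v (rename h phi) <-> sat (v \o h) phi.
Proof.
elim: phi W h v => //= {V} [V t u|V r ts|V phi IH psi IH'|V phi IH] W h v.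
- by rewrite !eval_rename.
- by under eq_fun do rewrite eval_rename.
- by rewrite IH IH'.
- have E x : scons x v \o omap h = scons x (v \o h) by apply/funext => -[].
  by split=> H x; move: (H x); rewrite IH E.
Qed.

Lemma eval_aut (M : structure L) (g : aut M) (V : Type) (v : V -> M)
  (t : term L V) : eval (g \o v) t = g (eval v t).
Proof.
by elim: t => //= f ts IH; rewrite aut_fint; congr fint; apply/funext.
Qed.

Lemma sat_aut (M : structure L) (g : aut M) (V : Type) (v : V -> M)
  (phi : formula L V) : sat (g \o v) phi <-> sat v phi.
Proof.
elim: phi v => //= {V} [V t u|V r ts|V phi IH psi IH'|V phi IH] v.
- by rewrite !eval_aut; split=> [/(can_inj (aut_funK g))|->].
- by under eq_fun do rewrite eval_aut; exact: aut_rint.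
- by rewrite IH IH'.
- have E x : g \o scons x v = scons (g x) (g \o v) by apply/funext => -[].
  split=> H x; first by rewrite -IH E; exact: H.
  by rewrite -(aut_invK g x) -E IH; exact: H.
Qed.

Lemma eval_support (M : structure L) (V : Type) (t : term L V) :
  exists s : set V, finite_set s /\
    forall v w : V -> M, (forall x, s x -> v x = w x) -> eval v t = eval w t.
Proof.
elim: t => [x|f ts IH] /=.
  by exists [set x]; split=> [|v w]; [exact: finite_set1|exact].
have [s sP] := choice IH.
exists (\bigcup_i s i); split.
  by apply: bigcup_finite => // i _; have [] := sP i.
move=> v w vw; congr fint; apply/funext => i; have [_] := sP i; apply=> x sx.
by apply: vw; exists i.
Qed.

Lemma sat_support (M : structure L) (V : Type) (phi : formula L V) :
  exists s : set V, finite_set s /\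
    forall v w : V -> M, (forall x, s x -> v x = w x) ->
      sat v phi <-> sat w phi.
Proof.
elim: phi => {V} [V t u|V r ts|V|V phi [s [fs sP]] psi [s' [fs' sP']]|
    V phi [s [fs sP]]] /=.
- have [s [fs sP]] := eval_support M t; have [s' [fs' sP']] := eval_support M u.
  exists (s `|` s'); split; first by rewrite finite_setU.
  move=> v w vw; rewrite (sP v w) ?(sP' v w) //.
    by move=> x ?; apply: vw; right.
  by move=> x ?; apply: vw; left.
- have [s sP] := choice (fun i => eval_support M (ts i)).
  exists (\bigcup_i s i); split.
    by apply: bigcup_finite => // i _; have [] := sP i.
  move=> v w vw; rewrite (_ : (fun i => eval v _) = fun i => eval w (ts i)) //.
  apply/funext => i; have [_] := sP i; apply=> x sx.
  by apply: vw; exists i.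
- by exists set0; split.
- exists (s `|` s'); split; first by rewrite finite_setU.
  move=> v w vw; rewrite (sP v w) ?(sP' v w) //.
    by move=> x ?; apply: vw; right.
  by move=> x ?; apply: vw; left.
- exists (Some @^-1` s); split.
    by apply: finite_preimage => // x y _ _ [].
  move=> v w vw.
  have E x : sat (scons x v) phi <-> sat (scons x w) phi.
    by apply: sP => -[y|] //= sy; exact: vw.
  by split=> H x; apply/E; exact: H.
Qed.

Definition Ex (V : Type) (phi : formula L (option V)) := Neg (All (Neg phi)).

Lemma sat_Ex (M : structure L) (V : Type) (v : V -> M) phi :
  sat v (Ex phi) <-> exists x, sat (scons x v) phi.
Proof.
rewrite /=; split=> [H|[x Hx] /(_ x)]; last exact.
by apply: contrapT => /forallNP.
Qed.

Definition exists_var (V : Type) (x : V) (phi : formula L V) :=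
  Ex (rename (fun y => if `[< y = x >] then None else Some y) phi).

Lemma sat_exists_var (M : structure L) (V : Type) (v : V -> M) x phi :
  sat v (exists_var x phi) <->
  exists w : V -> M, (forall y, y <> x -> w y = v y) /\ sat w phi.
Proof.
rewrite sat_Ex; split=> [[b]|[w [wv wphi]]].
  rewrite sat_rename => H; eexists; split; last exact: H.
  by move=> y yx /=; case: asboolP.
exists (w x); rewrite sat_rename; congr (sat _ phi): wphi.
by apply/funext => y /=; case: asboolP => [->//|/= /wv].
Qed.

Lemma sat_exists_vars (M : structure L) (N : structure L) (j : M -> N)
    (V : Type) (phi : formula L V) (v : V -> M) (w : V -> N) (s : set V) :
  elementary j -> finite_set s -> (forall x, ~ s x -> w x = j (v x)) ->
  sat w phi ->
  exists u : V -> M, (forall x, ~ s x -> u x = v x) /\ sat u phi.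
Proof.
move=> jel [n].
elim: n s phi w => [s phi w|n IH s phi w].
  rewrite II0 card_eq0 => /eqP -> wv wphi; exists v; split => //.
  have : sat j (rename v phi).
    rewrite sat_rename (_ : j \o v = w) //.
    by apply/funext => x /=; rewrite wv.
  by rewrite -jel sat_rename.
move=> /eq_cardSP [x sx sxn] wv wphi.
pose w' : V -> N := fun y => if `[< y = x >] then j (v x) else w y.
have [||u [uv]] := IH _ (exists_var x phi) w' sxn.
- move=> y sy; rewrite /w'; case: asboolP => [->//|yx].
  by apply: wv => sy'; apply: sy; split.
- rewrite sat_exists_var; exists w; split => // y yx.
  by rewrite /w'; case: asboolP.
rewrite sat_exists_var => -[u' [u'u u'phi]].
exists u'; split => // y sy; rewrite u'u; last by move=> yx; apply: sy; rewrite yx.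
by apply: uv => -[].
Qed.

Definition And (V : Type) (phi psi : formula L V) := Neg (Imp phi (Neg psi)).

Lemma sat_And (M : structure L) (V : Type) (v : V -> M) phi psi :
  sat v (And phi psi) <-> sat v phi /\ sat v psi.
Proof.
rewrite /=; split=> [H|[? ?]]; last exact.
by split; apply: contrapT => nH; apply: H.
Qed.

Lemma finite_conj (V : Type) (q : set (formula L V)) : finite_set q ->
  exists phi, forall (M : structure L) (v : V -> M),
    sat v phi <-> q `<=` [set psi | sat v psi].
Proof.
case=> n; elim: n q => [q|n IH q /eq_cardSP[phi qphi]].
  by rewrite II0 card_eq0 => /eqP ->; exists (Neg Bot) => M v; split=> [_ psi|_] [].
move=> /IH[psi psiP]; exists (And phi psi) => M v; rewrite sat_And psiP.
split=> [[vphi H] chi qchi|H].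
  by have [->//|cp] := pselect (chi = phi); apply: H; split.
by split; [exact: H|move=> chi [/H]].
Qed.

End sat_facts.

(* The index type I plays the role of lambda; pi is a partial type over the
   empty set in the variables (x_i), i in I, and X = pi(M). *)
Definition type_defines (L : language) (M : structure L) (I : Type)
    (pi : set (formula L I)) (X : set (I -> M)) :=
  X = [set a | forall phi, pi phi -> sat a phi].

Record type_space (L : language) (M : structure L) (I : Type)
    (pi : set (formula L I)) := TypeSpace {
  type_set :> formula L (I + M) -> Prop;
  type_finsat : finsat (fun c : M => c) type_set;
  type_complete : forall phi, type_set phi \/ type_set (Neg phi);
  type_extends : forall phi, pi phi -> type_set (rename inl phi) }.

Section type_space_facts.
Context (L : language) (M : structure L) (I : Type) (pi : set (formula L I)).

Lemma type_space_eq (p q : type_space M pi) :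
  (forall phi, p phi <-> q phi) -> p = q.
Proof.
case: p q => [p p1 p2 p3] [q q1 q2 q3] /= pq.
have {}pq : p = q by apply/seteqP; split=> phi /pq.
by subst q; congr TypeSpace; exact: Prop_irrelevance.
Qed.

HB.instance Definition _ := gen_eqMixin (type_space M pi).
HB.instance Definition _ := gen_choiceMixin (type_space M pi).
(* The Stone topology: the sets [phi] = {p | phi in p} form a subbase. *)
HB.instance Definition _ := isSubBaseTopological.Build (type_space M pi)
  [set: formula L (I + M)] (fun phi => [set p : type_space M pi | p phi]).

Definition inr_map (I P Q : Type) (h : P -> Q) (x : I + P) : I + Q :=
  match x with inl i => inl i | inr c => inr (h c) end.

(* phi(x, c) belongs to g p iff phi(x, g^-1 c) belongs to p. *)
Definition type_act (g : aut M) (p : type_space M pi) : type_space M pi.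
Proof.
exists [set phi | p (rename (inr_map (aut_inv g)) phi)].
- move=> q qfin qp.
  have [||a aq] := @type_finsat _ _ _ _ p (rename (inr_map (aut_inv g)) @` q).
  + exact: finite_image.
  + by move=> _ [phi qphi <-]; exact: qp.
  exists (g \o a) => phi qphi /=.
  have /= : sat (assign a (fun c => c)) (rename (inr_map (aut_inv g)) phi).
    by apply: aq; exists phi.
  rewrite sat_rename -(sat_aut g); congr (sat _ phi); apply/funext.
  by case=> //= c; rewrite aut_invK.
- by move=> phi; exact: (type_complete p (rename _ phi)).
- by move=> phi /type_extends /=; rewrite rename_comp; exact.
Defined.

End type_space_facts.

Definition type_restr (L : language) (M N : structure L) (j : M -> N)
    (jel : elementary j) (I : Type) (pi : set (formula L I))
    (p : type_space N pi) : type_space M pi.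
Proof.
exists [set phi | p (rename (inr_map j) phi)].
- move=> q qfin qp.
  have [||a aq] := @type_finsat _ _ _ _ p (rename (inr_map j) @` q).
  + exact: finite_image.
  + by move=> _ [phi qphi <-]; exact: qp.
  have [Phi PhiP] := finite_conj qfin.
  pose w := assign a (fun c : N => c) \o inr_map j.
  have wPhi : sat w Phi.
    apply/PhiP => phi qphi /=; rewrite /w -sat_rename; apply: aq.
    by exists phi.
  have [s [sfin sP]] := sat_support N Phi.
  have [m] := carrier_inhabited M.
  pose v : I + M -> M := assign (fun=> m) id.
  pose s' := s `&` range inl.
  pose w' x := if `[< s' x >] then w x else j (v x).
  have [|||u [uv uPhi]] := @sat_exists_vars _ _ _ j _ Phi v w' s' jel.
  + exact: finite_setIl.
  + by move=> x sx; rewrite /w'; case: asboolP.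
  + rewrite (sP w' w) // => x sx; rewrite /w'; case: asboolP => //.
    by case: x sx => [i|c] //= sx []; split => //; exists i.
  exists (u \o inl) => phi qphi /=; move/PhiP: uPhi => /(_ _ qphi) /=.
  congr (sat _ phi); apply/funext => -[//|c /=].
  by apply: uv => -[_ []].
- by move=> phi; exact: (type_complete p (rename _ phi)).
- by move=> phi /type_extends /=; rewrite rename_comp; exact.
Defined.

(* Weak almost periodicity involves no topology on G, so only an action of the
   abstract group by homeomorphisms is recorded; compactness and separation of
   Y are properties of the flows considered, not fields. *)
Record flow (G : groupType) (Y : topologicalType) := Flow {
  flow_act :> G -> Y -> Y;
  flow_act1 : forall y, flow_act 1%g y = y;
  flow_actM : forall g h y, flow_act (g * h)%g y = flow_act g (flow_act h y);
  flow_continuous : forall g, continuous (flow_act g) }.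

Section continuous_functions.
Context (R : realType) (Y : topologicalType).
Local Notation CY := (continuousType Y R).

Lemma cts_add_subproof (f g : CY) : continuous (fun y => f y + g y).
Proof.
by move=> y; exact: (continuousD (@cts_fun _ _ f y) (@cts_fun _ _ g y)).
Qed.
Lemma cts_opp_subproof (f : CY) : continuous (fun y => - f y).
Proof. by move=> y; exact: (continuousN (@cts_fun _ _ f y)). Qed.
Lemma cts_scale_subproof (a : R) (f : CY) : continuous (fun y => a * f y).
Proof.
by move=> y; exact: (continuousM (@cst_continuous _ _ a y) (@cts_fun _ _ f y)).
Qed.

Definition cts_zero : CY := cst 0.
Definition cts_add (f g : CY) : CY := mkcts (@cts_add_subproof f g).
Definition cts_opp (f : CY) : CY := mkcts (@cts_opp_subproof f).
Definition cts_scale (a : R) (f : CY) : CY := mkcts (@cts_scale_subproof a f).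

Lemma cts_addA : associative cts_add.
Proof. by move=> f g h; apply/continuousEP => y; exact: addrA. Qed.
Lemma cts_addC : commutative cts_add.
Proof. by move=> f g; apply/continuousEP => y; exact: addrC. Qed.
Lemma cts_add0 : left_id cts_zero cts_add.
Proof. by move=> f; apply/continuousEP => y; exact: add0r. Qed.
Lemma cts_addN : left_inverse cts_zero cts_opp cts_add.
Proof. by move=> f; apply/continuousEP => y; exact: addNr. Qed.

HB.instance Definition _ :=
  GRing.isZmodule.Build CY cts_addA cts_addC cts_add0 cts_addN.

Lemma cts_scaleA a b (f : CY) : cts_scale a (cts_scale b f) = cts_scale (a * b) f.
Proof. by apply/continuousEP => y; exact: mulrA. Qed.
Lemma cts_scale1 : left_id 1 cts_scale.
Proof. by move=> f; apply/continuousEP => y; exact: mul1r. Qed.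
Lemma cts_scaleDr : right_distributive cts_scale +%R.
Proof. by move=> a f g; apply/continuousEP => y; exact: mulrDr. Qed.
Lemma cts_scaleDl (f : CY) : {morph cts_scale^~ f : a b / a + b}.
Proof. by move=> a b; apply/continuousEP => y; exact: mulrDl. Qed.

HB.instance Definition _ := GRing.Zmodule_isLmodule.Build R CY
  cts_scaleA cts_scale1 cts_scaleDr cts_scaleDl.

Definition supnorm (f : CY) : R := sup (range (fun y => `|f y|)).

(* The topological dual of (C(Y), supnorm). *)
Record cts_dual := CtsDual {
  dual_fun :> {linear CY -> R^o};
  dual_bounded : exists K : R, forall f : CY, `|dual_fun f| <= K * supnorm f }.

(* C(Y) with its weak topology, i.e. the initial topology for the family of
   all elements of the dual.  This is a copy of [continuousType Y R], whose
   own topology in the library is a different one. *)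
Definition weak_C : Type :=
  initial_topology ((fun f u => u f) : CY -> {ptws cts_dual -> R^o}).

HB.instance Definition _ := Topological.on weak_C.

End continuous_functions.

Section wap.
Context (R : realType) (G : groupType) (Y : topologicalType).
Implicit Types phi : flow G Y.

Lemma translate_subproof phi (g : G) (f : continuousType Y R) :
  continuous (fun y => f (phi (g^-1)%g y)).
Proof.
move=> y; apply: (@continuous_comp _ _ _ (phi (g^-1)%g) f).
  exact: flow_continuous.
exact: cts_fun.
Qed.

Definition translate phi (g : G) (f : continuousType Y R) :
  continuousType Y R := mkcts (@translate_subproof phi g f).

Definition wap_fun phi (f : continuousType Y R) :=
  precompact (range (fun g => translate phi g f : weak_C R Y)).

Definition wap_flow phi := forall f : continuousType Y R, wap_fun phi f.

End wap.

Section quotient_flow.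
Context (G : groupType) (Y : topologicalType) (phi : flow G Y).
Local Open Scope quotient_scope.

Definition invariant_rel (F : equiv_rel Y) :=
  forall g x y, F x y -> F (phi g x) (phi g y).

Context (F : equiv_rel Y) (Finv : invariant_rel F).
Local Notation Q := (quotient_topology {eq_quot F}).

Definition quotient_act (g : G) (x : Q) : Q := \pi_Q (phi g (repr x)).

Lemma quotient_act_pi g y : quotient_act g (\pi_Q y) = \pi_Q (phi g y).
Proof.
suff E : \pi_{eq_quot F} (phi g (repr (\pi_Q y))) = \pi_{eq_quot F} (phi g y).
  exact: E.
apply/eqmodP/Finv; apply/eqmodP; exact: (@reprK _ Q (\pi_Q y)).
Qed.

Lemma quotient_act1 x : quotient_act 1%g x = x.
Proof. by rewrite -[x]reprK quotient_act_pi flow_act1. Qed.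

Lemma quotient_actM g h x :
  quotient_act (g * h)%g x = quotient_act g (quotient_act h x).
Proof.
have <- : \pi_Q (repr x) = x by exact: reprK.
by rewrite quotient_act_pi (quotient_act_pi h) quotient_act_pi flow_actM.
Qed.

Lemma quotient_act_continuous g : continuous (quotient_act g).
Proof.
apply/quotient_continuous.
rewrite (_ : _ \o _ = \pi_Q \o phi g).
  move=> y; apply: continuous_comp; first exact: flow_continuous.
  exact: pi_continuous.
by apply/funext => y /=; rewrite quotient_act_pi.
Qed.

Definition quotient_flow : flow G Q :=
  Flow quotient_act1 quotient_actM quotient_act_continuous.

End quotient_flow.

Definition wap_quotient_rel (R : realType) (G : groupType)
    (Y : topologicalType) (phi : flow G Y) (F : equiv_rel Y) :=
  closed [set xy : Y * Y | F xy.1 xy.2] /\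
  exists Finv : invariant_rel phi F, wap_flow R (quotient_flow Finv).

Definition is_F_WAP (R : realType) (G : groupType)
    (Y : topologicalType) (phi : flow G Y) (F : equiv_rel Y) :=
  wap_quotient_rel R phi F /\
  forall E : equiv_rel Y, wap_quotient_rel R phi E ->
    forall x y, F x y -> E x y.

Section type_flow.
Context (L : language) (M : structure L) (I : Type) (pi : set (formula L I)).

Lemma type_act1 (p : type_space M pi) : type_act 1%g p = p.
Proof.
apply: type_space_eq => phi /=.
by rewrite (_ : inr_map _ = id) ?rename_id//; apply/funext => -[].
Qed.

Lemma type_actM (g h : aut M) (p : type_space M pi) :
  type_act (g * h)%g p = type_act g (type_act h p).
Proof.
apply: type_space_eq => phi /=; rewrite rename_comp.
by rewrite (_ : _ \o _ = inr_map (aut_inv (g * h)%g))//; apply/funext => -[].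
Qed.

Lemma type_act_continuous (g : aut M) : continuous (@type_act L M I pi g).
Proof.
apply/continuousP => A [D DI <-]; rewrite preimage_bigcup.
exists [set @type_act L M I pi g @^-1` B | B in D]; last first.
  by rewrite bigcup_image.
move=> _ [B /DI[S _ <-] <-].
exists [fset rename (inr_map (aut_inv g)) psi | psi in S]%fset.
  by move=> ? _; rewrite inE.
apply/seteqP; split=> [p pS psi psiS|p pS _ /imfsetP[psi psiS ->]].
  by apply: pS => /=; apply/imfsetP; exists psi.
exact: pS.
Qed.

Definition type_flow : flow (aut M) (type_space M pi) :=
  Flow type_act1 type_actM type_act_continuous.

End type_flow.

(* Main.v *)
(** Relative weak compactness of an orbit in [C(Y)] is equivalent to a condition
    on sequences of translates: the convex hulls of an initial segment and of
    the corresponding tail come uniformly close to each other.  Mazur's theorem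
    gives one implication and an ultrafilter argument in the style of James the
    other.  The condition involves countably many translates, and a continuous
    function on a type space involves countably many parameters, so both can be
    moved between C' and C by saturation and homogeneity.

    Let D' be the closure in S_X(C') of the types of tuples of X(C); it maps
    onto S_X(C).  For r[F'] in F, the relation "r(s p) F r(s q) for all s in
    Aut(C')" is closed and invariant, and its quotient is WAP: a continuous
    function on it is, after translation, f o r with f continuous on S_X(C)/F.
    For F in r[F'], any two elements of D' with the same restriction are
    F'-equivalent: for a continuous k on S_X(C')/F', moving the parameters of k
    into C yields a weak limit of translates of k that agrees with k on D' and
    factors through r.  Hence S_X(C) maps continuously to S_X(C')/F', and the
    kernel of that map is a WAP relation contained in r[F'].  *)
Require Import Defs.
From HB Require Import structures.
From mathcomp Require Import all_boot all_order all_algebra finmap.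
From mathcomp Require Import all_classical all_reals all_analysis.
From mathcomp Require Import ring lra.

Set Implicit Arguments.
Unset Strict Implicit.
Unset Printing Implicit Defensive.

Import Order.TTheory GRing.Theory Num.Theory.
Import numFieldNormedType.Exports.

Local Open Scope classical_set_scope.
Local Open Scope ring_scope.

(** * Weak compactness in C(Y) *)

Section mazur_orlicz.
Context (R : realType) (V : lmodType R).
Implicit Types (p q : V -> R) (D : set V) (b : R).

Definition sublinear q := (forall x y, q (x + y) <= q x + q y) /\
  forall (t : R) x, 0 < t -> q (t *: x) <= t * q x.

Definition convex_subset D := forall x y (t : R), 0 <= t <= 1 -> D x -> D y ->
  D (t *: x + (1 - t) *: y).

Lemma sublinear0 q : sublinear q -> q 0 = 0.
Proof.
move=> [_ qZ]; have := qZ 2 0; have := qZ 2^-1 0; rewrite !scaler0; lra.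
Qed.

Lemma sublinear_oppl q x : sublinear q -> - q (- x) <= q x.
Proof.
by move=> q_; have := (q_.1 x (- x)); rewrite subrr sublinear0//; lra.
Qed.

Lemma sublinearZ q (t : R) x : sublinear q -> 0 <= t -> q (t *: x) = t * q x.
Proof.
move=> q_; rewrite le_eqVlt => /orP[/eqP<-|t0].
  by rewrite scale0r mul0r sublinear0.
apply/eqP; rewrite eq_le q_.2//=.
have ti : 0 < t^-1 by rewrite invr_gt0.
have := q_.2 t^-1 (t *: x) ti.
by rewrite scalerA mulVf ?gt_eqF// scale1r mulrC ler_pdivlMr// mulrC.
Qed.

(* The largest sublinear functional below [p] that is at most [- b] on [- D]. *)
Definition push p D b (x : V) : R :=
  inf [set y | exists (t : R) d, [/\ 0 <= t, D d & y = p (x + t *: d) - t * b]].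

Section push.
Context (p : V -> R) (D : set V) (b : R).
Hypotheses (p_ : sublinear p) (D0 : D !=set0) (Dconv : convex_subset D)
  (bD : forall d, D d -> b <= p d).

(** Subadditivity gives [p (t *: d) <= p (x + t *: d) + p (- x)], and [t * b] bounds the left side
    below; so the infimum is finite. *)
Lemma push_lbound x : has_lbound
  [set y | exists (t : R) d, [/\ 0 <= t, D d & y = p (x + t *: d) - t * b]].
Proof.
exists (- p (- x)) => _ [t [d [t0 Dd ->]]].
have := p_.1 (x + t *: d) (- x); rewrite addrAC subrr add0r sublinearZ//.
have := bD Dd => /(ler_wpM2l t0); lra.
Qed.

Lemma push_le x (t : R) d : 0 <= t -> D d -> push p D b x <= p (x + t *: d) - t * b.
Proof. by move=> t0 Dd; apply: ge_inf; [exact: push_lbound|exists t, d]. Qed.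

Lemma le_push x z :
  (forall (t : R) d, 0 <= t -> D d -> z <= p (x + t *: d) - t * b) ->
  z <= push p D b x.
Proof.
move=> zle; apply: lb_le_inf; last by move=> _ [t [d [t0 Dd ->]]]; exact: zle.
by have [d Dd] := D0; exists (p (x + 0 *: d) - 0 * b), 0, d.
Qed.

Lemma push_le_self x : push p D b x <= p x.
Proof.
have [d Dd] := D0; have := @push_le x 0 d (lexx _) Dd.
by rewrite scale0r addr0 mul0r subr0.
Qed.

Lemma push_sublinear : sublinear (push p D b).
Proof.
split=> [x y|t x t0].
  rewrite -lerBlDr; apply: le_push => t d t0 Dd.
  rewrite lerBlDr [leRHS]addrC -lerBlDr; apply: le_push => s e s0 De.
  (* The choices [(t, d)] and [(s, e)] are merged into the weight [t + s] and the convex combination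
     of [d] and [e] with weights proportional to [t] and [s], which requires [t + s] to be
     nonzero. *)
  rewrite lerBlDr; have [ts0|ts] := eqVneq (t + s) 0.
    have [-> ->] : t = 0 /\ s = 0 by split; lra.
    rewrite !scale0r !addr0; have := push_le_self (x + y); have := p_.1 x y; lra.
  have ts0 : 0 < t + s by rewrite lt_def ts; lra.
  have Du : D ((t / (t + s)) *: d + (1 - t / (t + s)) *: e).
    apply: Dconv => //; rewrite divr_ge0//= ?ler_pdivrMr//; lra.
  apply: (le_trans (push_le _ (ltW ts0) Du)).
  have -> : (t + s) *: ((t / (t + s)) *: d + (1 - t / (t + s)) *: e) =
      t *: d + s *: e.
    by rewrite scalerDr !scalerA; congr (_ *: _ + _ *: _); field.
  rewrite addrACA.
  by have := p_.1 (x + t *: d) (y + s *: e); lra.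
rewrite -ler_pdivrMl//; apply: le_push => s d s0 Dd.
rewrite ler_pdivrMl//.
have ts : 0 <= t * s by rewrite mulr_ge0// ltW.
apply: (le_trans (push_le _ ts Dd)).
rewrite -scalerA -scalerDr sublinearZ//; last exact: ltW.
by rewrite le_eqVlt; apply/orP; left; apply/eqP; ring.
Qed.

End push.

(** Zorn's lemma: the infimum of a nonempty chain is finite, as every member is at least [- p (- x)]
    at [x], and it is subadditive, as the smaller of two members can serve for both. *)
Lemma minimal_sublinear p : sublinear p -> exists2 q, sublinear q &
  (forall x, q x <= p x) /\
  forall q', sublinear q' -> (forall x, q' x <= q x) -> q' = q.
Proof.
move=> p_; pose P q := sublinear q /\ forall x, q x <= p x.
(* The order is reversed, so that a maximal element for [r] is a minimal functional. *)
pose r (a b : {q | P q}) := `[< forall x, sval b x <= sval a x >].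
have [||||[q [q_ qp]] qmin] := @Zorn _ r.
- by move=> a; apply/asboolP => x.
- move=> a b c /asboolP ba /asboolP cb; apply/asboolP => x.
  exact: le_trans (cb x) (ba x).
- move=> [a aP] [b bP] /asboolP/= ba /asboolP/= ab; apply: eq_exist.
  by apply/funext => x; apply/eqP; rewrite eq_le ab ba.
- move=> A Atot; have [A0|/set0P [a0 Aa0]] := eqVneq A set0.
    by exists (exist P p (conj p_ (fun=> lexx _))); rewrite A0.
  pose q x := inf [set sval a x | a in A].
  have lb x : has_lbound [set sval a x | a in A].
    exists (- p (- x)) => _ [[a [a_ ap]] Aa <-] /=.
    by have := sublinear_oppl x a_; have := ap (- x); lra.
  have qle a x : A a -> q x <= sval a x.
    by move=> Aa; apply: ge_inf; [exact: lb|exists a].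
  have le_q z x : (forall a, A a -> z <= sval a x) -> z <= q x.
    move=> zle; apply: lb_le_inf; first by exists (sval a0 x), a0.
    by move=> _ [a Aa <-]; exact: zle.
  have Pq : P q.
    split; last first.
      by move=> x; apply: le_trans (qle _ x Aa0) _; exact: (svalP a0).2.
    split=> [x y|t x t0].
      rewrite -lerBlDr; apply: (le_q) => a Aa.
      suff : q (x + y) - sval a x <= q y by lra.
      apply: (le_q) => b Ab; rewrite lerBlDr.
      have [/asboolP ba|/asboolP ab] := Atot _ _ Aa Ab.
        have := qle _ (x + y) Ab; have := (svalP b).1.1 x y; have := ba x; lra.
      have := qle _ (x + y) Aa; have := (svalP a).1.1 x y; have := ab y; lra.
    rewrite -ler_pdivrMl//; apply: (le_q) => a Aa; rewrite ler_pdivrMl//.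
    exact: le_trans (qle _ _ Aa) ((svalP a).1.2 _ _ t0).
  by exists (exist P q Pq) => a Aa; apply/asboolP => x /=; exact: qle.
exists q => //; split=> // q' q'_ q'q.
have Pq' : P q' by split=> // x; exact: le_trans (q'q x) (qp x).
have /qmin/(congr1 sval)// : r (exist P q (conj q_ qp)) (exist P q' Pq').
exact/asboolP.
Qed.

(** A functional [q] minimal below [push p D b] is linear: pushing [q] along a single point [x]
    cannot lower it, which forces [q (- x) = - q x]. The bound on [D] comes from
    [push p D b (- d) <= - b]. *)
Lemma mazur_orlicz p D b : sublinear p -> D !=set0 -> convex_subset D ->
  (forall d, D d -> b <= p d) ->
  exists u : {linear V -> R^o}, (forall x, u x <= p x) /\ forall d, D d -> b <= u d.
Proof.
move=> p_ D0 Dconv bD.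
have pD := push_sublinear p_ D0 Dconv bD.
have [q q_ [qle qmin]] := minimal_sublinear pD.
have qN x : q (- x) = - q x.
  have D1 : [set x] !=set0 by exists x.
  have cD : convex_subset [set x].
    by move=> _ _ t _ -> ->; rewrite -scalerDl addrC subrK scale1r.
  have bD1 d : [set x] d -> q x <= q d by move=> ->.
  have := push_le q_ bD1 (- x) ler01 (erefl : [set x] x).
  rewrite (qmin (push q [set x] (q x))).
  - rewrite scale1r addNr sublinear0// mul1r.
    by have := sublinear_oppl x q_; lra.
  - exact: push_sublinear.
  - by move=> y; exact: push_le_self.
have qD x y : q (x + y) = q x + q y.
  have := q_.1 x y; have := q_.1 (x + y) (- y); rewrite addrK qN; lra.
have qZ t x : q (t *: x) = t * q x.
  have [t0|t0] := leP 0 t; first exact: sublinearZ.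
  have -> : t *: x = - ((- t) *: x) by rewrite scaleNr opprK.
  by rewrite qN sublinearZ ?oppr_ge0 ?ltW// mulNr opprK.
have qlin : linear_for *:%R (q : V -> R^o) by move=> t x y; rewrite qD qZ.
pose uM := GRing.isLinear.Build R V R^o *:%R (q : V -> R^o) qlin.
pose u : {linear V -> R^o} := HB.pack (q : V -> R^o) uM.
exists u; split=> [x|d Dd] /=.
  exact: le_trans (qle x) (push_le_self p_ D0 bD x).
have := qle (- d); have := push_le p_ bD (- d) ler01 Dd.
rewrite scale1r addNr sublinear0// mul1r qN; lra.
Qed.

End mazur_orlicz.

(** * The weak topology of C(Y) and its functionals *)

Section weak_topology.
Context (R : realType) (Y : topologicalType).
Local Notation CY := (continuousType Y R).
Local Notation WY := (weak_C R Y).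
Implicit Types (f h : CY) (u : cts_dual R Y).

Lemma weak_cvgP (F : set_system WY) (h : WY) : Filter F ->
  F --> h <-> forall u (e : R), 0 < e -> F [set f | `|u h - u f| < e].
Proof.
move=> FF; split=> [Fh u e e0|Fh].
  pose ev : CY -> {ptws cts_dual R Y -> R^o} := fun f u => u f.
  have /cvg_sup/(_ u) evu : ev @ F --> ev h.
    exact: cvg_comp Fh (@initial_continuous CY _ ev (h : initial_topology ev)).
  have : nbhs (u h : R^o) (ball (u h : R^o) e) by exact: nbhsx_ballx.
  by move=> /(@initial_continuous _ _ (fun g : cts_dual R Y -> R^o => g u)) /evu.
move=> A /= [_ [[B Bop <-] Bh sBA]].
rewrite nbhs_filterE; apply: filterS sBA _.
pose ev : CY -> {ptws cts_dual R Y -> R^o} := fun f u => u f.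
have : ev @ F --> ev h.
  apply/cvg_sup => u; move=> C /= [_ [[D Dop <-] Dh sDC]].
  rewrite nbhs_filterE; apply: filterS sDC _.
  have : nbhs (u h : R^o) D by exact: open_nbhs_nbhs.
  move=> /nbhs_ballP[e /= e0 eD]; apply: filterS (Fh u e e0) => f /= uf.
  exact: eD.
by apply; exact: open_nbhs_nbhs.
Qed.

(** Finitely many functionals are approximated by one common [f], because weak neighbourhoods are
    stable under finite intersection. *)
Lemma weak_cluster (F : set_system WY) (h : WY) : Filter F -> cluster F h ->
  forall (s : seq (cts_dual R Y)) (e : R) (A : set WY), 0 < e -> F A ->
  exists2 f, A f & forall u, List.In u s -> `|u h - u f| < e.
Proof.
move=> FF Fh s e A e0 FA.
suff : nbhs h [set f | forall u, List.In u s -> `|u h - u f| < e].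
  by move=> /(Fh _ _ FA) [f [Af fP]]; exists f.
have hh := (weak_cvgP h (nbhs_filter h)).1 (@cvg_id _ (nbhs h)).
elim: s => [|u s IH]; first by apply: filterS filterT => f _ u [].
by apply: filterS2 (hh u e e0) IH => f uf sf v [<-|/sf].
Qed.

Hypothesis Ycompact : compact [set: Y].

Lemma cts_bounded f : exists K : R, forall y, `|f y| <= K.
Proof.
have /compact_bounded : compact [set (f : Y -> R^o) y | y in [set: Y]].
  by apply: continuous_compact => //; apply: continuous_subspaceT; exact: cts_fun.
move=> /ex_strict_bound_gt0[K _ fK]; exists K => y; apply: ltW; apply: fK.
exact: imageP.
Qed.

Lemma le_supnorm f y : `|f y| <= supnorm f.
Proof.
have [K fK] := cts_bounded f.
by apply: ub_le_sup; [exists K => _ [z _ <-]|exists y].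
Qed.

(** The condition [0 <= K] covers an empty [Y], where the supremum is [0]. *)
Lemma supnorm_le f K : 0 <= K -> (forall y, `|f y| <= K) -> supnorm f <= K.
Proof.
move=> K0 fK; rewrite /supnorm; set E := (X in sup X).
have [E0|/set0P E0] := eqVneq E set0; first by rewrite E0 sup0.
by apply: ge_sup => // _ [y _ <-].
Qed.

Lemma supnorm_ge0 f : 0 <= supnorm f.
Proof.
have [y|Y0] := pselect (exists y : Y, True).
  by have [z _] := y; exact: le_trans (normr_ge0 _) (le_supnorm f z).
rewrite /supnorm (_ : range (fun y => `|f y|) = set0) ?sup0//.
by apply/seteqP; split=> // x [y]; case: Y0; exists y.
Qed.

Lemma supnorm_sublinear : sublinear (@supnorm R Y).
Proof.
split=> [f h|t f t0].
  apply: supnorm_le => [|y]; first by rewrite addr_ge0 ?supnorm_ge0.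
  exact: le_trans (ler_normD _ _) (lerD (le_supnorm f y) (le_supnorm h y)).
apply: supnorm_le => [|y]; first by rewrite mulr_ge0 ?supnorm_ge0// ltW.
by rewrite /= normrM gtr0_norm// ler_pM2l// le_supnorm.
Qed.

Definition point_eval (y : Y) : CY -> R^o := fun f => f y.

Lemma point_eval_linear y : linear_for *:%R (point_eval y).
Proof. by []. Qed.

HB.instance Definition _ y := GRing.isLinear.Build R CY R^o *:%R
  (point_eval y) (@point_eval_linear y).

Lemma point_eval_bounded y :
  exists K : R, forall f, `|point_eval y f| <= K * supnorm f.
Proof. by exists 1 => f; rewrite mul1r le_supnorm. Qed.

Definition point_dual y : cts_dual R Y := CtsDual (point_eval_bounded y).

(** Applying the bound to [- f] makes it two-sided. This turns a Mazur-Orlicz functional into an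
    element of the dual. *)
Lemma dominated_dual (u : {linear CY -> R^o}) : (forall f, u f <= supnorm f) ->
  exists v : cts_dual R Y, forall f, v f = u f.
Proof.
move=> ule; have ub : exists K : R, forall f, `|u f| <= K * supnorm f.
  exists 1 => f; rewrite mul1r ler_norml ule andbT.
  have := ule (- f); rewrite linearN.
  suff : supnorm (- f) <= supnorm f by lra.
  by apply: supnorm_le => [|y]; rewrite ?supnorm_ge0//= normrN le_supnorm.
by exists (CtsDual ub).
Qed.

Lemma dual_lipschitz u : exists2 K : R, 0 < K & forall (f h : CY) (d : R), 0 <= d ->
  (forall y, `|f y - h y| <= d) -> `|u f - u h| <= K * d.
Proof.
have [K uK] := dual_bounded u; exists (`|K| + 1) => [|f h d d0 fh].
  by rewrite ltr_wpDl.
have fh' : supnorm (f - h) <= d by exact: supnorm_le.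
rewrite -linearB; apply: (le_trans (uK _)).
apply: (@le_trans _ _ ((`|K| + 1) * supnorm (f - h))).
  by rewrite ler_wpM2r ?supnorm_ge0//; have := ler_norm K; lra.
by rewrite ler_wpM2l//; have := normr_ge0 K; lra.
Qed.

End weak_topology.

(** * Convex hulls and recurrent sets of functions *)

Section convex_hull.
Context (R : realType) (V : lmodType R).
Implicit Types A B : set V.

(** Binary combinations allow facts about hulls to be proved by induction rather than through finite
    sums. *)
Inductive conv A : set V :=
| conv_in x of A x : conv A x
| conv_comb x y (t : R) of 0 <= t <= 1 & conv A x & conv A y :
    conv A (t *: x + (1 - t) *: y).

Lemma conv_sub A B : A `<=` B -> convex_subset B -> conv A `<=` B.
Proof. by move=> AB cB x; elim=> [y /AB|y z t t01 _ By _ Bz]//; exact: cB. Qed.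

Lemma conv_convex A : convex_subset (conv A).
Proof. by move=> x y t t01 Ax Ay; exact: conv_comb. Qed.

Lemma conv_mono A B : A `<=` B -> conv A `<=` conv B.
Proof. by move=> AB; apply: conv_sub (@conv_convex B) => x /AB; exact: conv_in. Qed.

Lemma conv_finite_support (h : nat -> V) (c : V) : conv (range h) c ->
  exists m, conv [set h k | k in [set k | (k < m)%N]] c.
Proof.
elim=> [_ [k _ <-]|x y t t01 _ [m xm] _ [n yn]].
  by exists k.+1; apply: conv_in; exists k => /=.
exists (maxn m n); apply: conv_comb => //.
  apply: conv_mono xm => _ [k /= km <-]; exists k => //=.
  by rewrite leq_max km.
apply: conv_mono yn => _ [k /= kn <-]; exists k => //=.
by rewrite leq_max kn orbT.
Qed.

End convex_hull.

Lemma cts_combE (R : realType) (Y : topologicalType) (t s : R)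
  (f g : continuousType Y R) z : (t *: f + s *: g) z = t * f z + s * g z.
Proof. by []. Qed.

(* A substitute for relative weak compactness, in the spirit of James: only
   countably many elements of [H] are involved at a time. *)
Definition recurrent (R : realType) (Y : topologicalType)
    (H : set (continuousType Y R)) :=
  forall h : nat -> continuousType Y R, (forall n, H (h n)) ->
  forall e : R, 0 < e -> exists m c1 c2,
  [/\ conv [set h k | k in [set k | (k < m)%N]] c1,
      conv [set h k | k in [set k | (m <= k)%N]] c2 &
      forall y, `|c1 y - c2 y| <= e].

(** Composition with [theta] commutes with convex combinations and preserves uniform bounds. Here
    [theta] is an arbitrary map, chosen after the sequence. *)
Lemma recurrent_transfer (R : realType) (Y Y' : topologicalType)
    (H : set (continuousType Y R)) (H' : set (continuousType Y' R)) : recurrent H ->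
  (forall h' : nat -> continuousType Y' R, (forall n, H' (h' n)) ->
     exists (h : nat -> continuousType Y R) (theta : Y' -> Y), (forall n, H (h n)) /\
       forall n y', h' n y' = h n (theta y')) ->
  recurrent H'.
Proof.
move=> Hrec HH' h' h'H e e0; have [h [theta [hH h'h]]] := HH' h' h'H.
have [m [c1 [c2 [c1m c2m c12]]]] := Hrec h hH e e0.
have lift (P : set nat) c : conv [set h k | k in P] c ->
    exists2 c', conv [set h' k | k in P] c' & forall y', c' y' = c (theta y').
  elim=> [_ [k Pk <-]|x y t t01 _ [x' cx' xx'] _ [y' cy' yy']].
    by exists (h' k) => //; apply: conv_in; exists k.
  exists (t *: x' + (1 - t) *: y'); first exact: conv_comb.
  by move=> z; rewrite !cts_combE xx' yy'.
have [c1' c1'm c1'E] := lift _ _ c1m; have [c2' c2'm c2'E] := lift _ _ c2m.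
exists m, c1', c2'; split=> // y'; rewrite c1'E c2'E; exact: c12.
Qed.

(** * Relative weak compactness compared with recurrence *)

Section compact_recurrent.
Context (R : realType) (Y : topologicalType).
Local Notation CY := (continuousType Y R).
Local Notation WY := (weak_C R Y).

Hypothesis Ycompact : compact [set: Y].

Lemma pair_eval_bounded (y z : Y) : exists K : R, forall f : CY,
  `|(point_eval y \- point_eval z) f| <= K * supnorm f.
Proof.
exists 2 => f; rewrite /= mulr_natl mulr2n.
exact: le_trans (ler_normB _ _)
  (lerD (le_supnorm Ycompact f y) (le_supnorm Ycompact f z)).
Qed.

Definition pair_dual y z : cts_dual R Y := CtsDual (pair_eval_bounded y z).

(** The sets of elements of [K] meeting finitely many requirements up to [e] form a filter base; a
    cluster point in [K] meets all requirements exactly. *)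
Lemma compact_interpolation (K : set WY) (Z : Type) (v : Z -> cts_dual R Y)
    (T : Z -> R) : compact K ->
  (forall (s : seq Z) (e : R), 0 < e ->
     exists2 f, K f & forall z, List.In z s -> `|v z f - T z| < e) ->
  exists2 h, K h & forall z, v z h = T z.
Proof.
move=> Kc Kap.
pose B (se : seq Z * R) := K `&`
  [set f | forall z, List.In z se.1 -> `|v z f - T z| < se.2].
pose F := filter_from [set se : seq Z * R | 0 < se.2] B.
have FF : ProperFilter F.
  apply: filter_from_proper; last first.
    by move=> [s e] /= /(Kap s e)[f Kf fP]; exists f.
  apply: filter_from_filter; first by exists ([::], 1) => /=.
  move=> [s e] [s' e'] /= e0 e'0; exists (s ++ s', Num.min e e') => /=.
    by rewrite lt_min e0.
  move=> f [Kf fP]; split; split=> // z zs.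
    have : `|v z f - T z| < Num.min e e' by apply: fP; apply/List.in_app_iff; left.
    by rewrite lt_min => /andP[].
  have : `|v z f - T z| < Num.min e e' by apply: fP; apply/List.in_app_iff; right.
  by rewrite lt_min => /andP[].
have FK : F K by exists ([::], 1) => //= f [].
have [h [Kh Fh]] := Kc F FF FK; exists h => // z.
apply/eqP; rewrite -subr_eq0 -normr_le0; apply/ler_addgt0Pr => e e0.
have e2 : 0 < e / 2 by rewrite divr_gt0.
have FB : F (B ([:: z], e / 2)) by exists ([:: z], e / 2).
have [f [_ fP] fh] := weak_cluster _ Fh [:: v z] e2 FB.
have := fP z (or_introl erefl); have := fh (v z) (or_introl erefl).
rewrite /= add0r => h1 h2.
rewrite (_ : v z h - T z = (v z h - v z f) + (v z f - T z)); last by ring.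
by apply: (le_trans (ler_normD _ _)); lra.
Qed.

(** By Mazur's theorem a weak cluster point [g] of the sequence is a uniform limit of elements of
    the hull of any tail. One element near [g] uses finitely many terms; a second is then taken from
    the tail beyond them. *)
Lemma compact_recurrent (K : set WY) : compact K -> recurrent K.
Proof.
move=> Kc h hK e e0.
pose F : set_system WY := (h : nat -> WY) @ \oo.
have FF : ProperFilter F by exact: fmap_proper_filter.
have FK : F K by exists 0%N => // n _; exact: hK.
have [g [Kg Fg]] := Kc F FF FK.
have near_hull m (d : R) : 0 < d ->
    exists2 c, conv [set h k | k in [set k | (m <= k)%N]] c &
      forall y, `|c y - g y| <= d.
  (* If the hull stayed away from [g], a functional dominated by the norm would be at least [d] on
     the difference set [D], against the choice of [g]. *)
  move=> d0; apply: contrapT => /forall2NP noc.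
  pose D := [set c - g | c in conv [set h k | k in [set k | (m <= k)%N]]].
  have D0 : D !=set0.
    by exists (h m - g), (h m) => //; apply: conv_in; exists m => /=.
  have Dconv : convex_subset D.
    move=> _ _ t t01 [c cc <-] [c' cc' <-].
    exists (t *: c + (1 - t) *: c'); first exact: conv_comb.
    rewrite !scalerBr addrACA -opprD -scalerDl [t + _]addrC subrK.
    by rewrite scale1r.
  have dD (x : CY) : D x -> d <= supnorm x.
    move=> [c cc <-]; rewrite leNgt; apply/negP => cd.
    have [//|] := noc c; apply=> y; apply: ltW; apply: le_lt_trans cd.
    exact: (le_supnorm Ycompact (c - g) y).
  have [u [ule uD]] := mazur_orlicz (supnorm_sublinear R Ycompact) D0 Dconv dD.
  have [v vu] := dominated_dual Ycompact ule.
  have Fm : F [set h k | k in [set k | (m <= k)%N]].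
    by exists m => // k /= mk; exists k.
  have [_ [k mk <-]] := weak_cluster _ Fg [:: v] d0 Fm.
  move=> /(_ v (or_introl erefl)).
  have : d <= u (h k - g).
    by apply: uD; exists (h k) => //; apply: conv_in; exists k.
  by rewrite !vu linearB /= ltr_norml; lra.
have e2 : 0 < e / 2 by rewrite divr_gt0.
have [c1 c1h c1g] := near_hull 0%N _ e2.
have [m c1m] : exists m, conv [set h k | k in [set k | (k < m)%N]] c1.
  by apply: conv_finite_support; apply: conv_mono c1h => _ [k _ <-]; exists k.
have [c2 c2m c2g] := near_hull m _ e2.
exists m, c1, c2; split=> // y.
have := c1g y; have := c2g y; rewrite !ler_norml; lra.
Qed.

End compact_recurrent.

(** An ultrafilter [W] on the closure of [H] is compared with an ultrafilter [U] that contains [H]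
    and all open members of [W]. The limit of [U] is a limit of [W]: otherwise, by regularity, the
    complement of a closed neighbourhood of it would be an open member of [W], hence of [U]. *)
Lemma ultra_precompact (T : topologicalType) (H : set T) : regular_space T ->
  (forall U : set_system T, UltraFilter U -> U H -> exists e : T, U --> e) ->
  precompact H.
Proof.
move=> Treg Hlim; rewrite precompactE compact_ultra => W WU WH.
pose B := [set O : set T | open O /\ W O].
pose F := filter_from B (fun O => H `&` O).
have WP : ProperFilter W by exact: ultra_proper.
have FF : ProperFilter F.
  apply: filter_from_proper; last first.
    move=> O [Oo WO].
    have [x [xH xO]] : closure H `&` O !=set0.
      by apply: (@filter_ex _ W); exact: filterI.
    by apply: xH; exact: open_nbhs_nbhs.
  apply: filter_from_filter.
    by exists setT; split; [exact: openT|exact: filterT].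
  move=> O P [Oo WO] [Po WP']; exists (O `&` P) => [|x [Hx []]].
    by split; [exact: openI|exact: filterI].
  by split; split.
have [U [UU FU]] := ultraFilterLemma FF.
have UP : ProperFilter U by exact: ultra_proper.
have UH : U H.
  apply: FU; exists setT; last by move=> x [].
  by split; [exact: openT|exact: filterT].
have [e Ue] := Hlim U UU UH.
suff We : W --> e.
  exists e; split=> // A eA.
  have [x [xH xA]] : closure H `&` interior A !=set0.
    apply: (@filter_ex _ W); apply: filterI => //.
    by apply: We; exact: nbhs_interior.
  by apply: xH.
move=> A /Treg[N Ne NA].
have [WN|WN] := in_ultra_setVsetC (closure N) WU; first exact: filterS WN.
have UN : U N by apply: Ue.
have UC : U (~` closure N).
  apply: FU; exists (~` closure N); last by move=> x [].
  by split=> //; exact/closed_openC/closed_closure.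
have [x [Nx]] : N `&` ~` closure N !=set0 by apply: (@filter_ex _ U); exact: filterI.
by case; exact: subset_closure.
Qed.

Section recurrent_precompact.
Context (R : realType) (Y : topologicalType).
Local Notation CY := (continuousType Y R).
Local Notation WY := (weak_C R Y).
Hypothesis Ycompact : compact [set: Y].

Definition totally_bounded (B : set CY) := forall d : R, 0 < d ->
  exists s : seq CY, forall v, B v ->
    exists2 w, List.In w s & forall y, `|v y - w y| <= d.

(** The Minkowski sum of [B] and the segment from [0] to [h]. When [B] contains [0], the sum
    contains both [B] and [h]. *)
Definition segment_sum (B : set CY) (h : CY) : set CY :=
  [set v | exists (w : CY) (t : R), [/\ B w, 0 <= t <= 1 & v = w + t *: h]].

Lemma totally_bounded_segment B h : totally_bounded B ->
  totally_bounded (segment_sum B h).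
Proof.
move=> Btb d d0; have [K hK] := cts_bounded Ycompact h.
have [s sP] := Btb (d / 2) (divr_gt0 d0 (ltr0Sn _ 1)).
(* A grid of step [1 / n] on the segment is fine enough for one step along [h] to change values by
   at most [d / 2]. *)
pose n := (Num.bound (2 * `|K| / d)).+1.
have nP : `|K| <= n%:R * (d / 2).
  have : 2 * `|K| / d <= n%:R.
    rewrite ltW//; apply: lt_le_trans (archi_boundP _) _.
      by apply: divr_ge0; [exact: mulr_ge0|exact: ltW].
    by rewrite ler_nat.
  by rewrite ler_pdivrMr//; lra.
have n0 : 0 < n%:R :> R by rewrite ltr0n.
exists (List.flat_map
  (fun w => List.map (fun i => w + (i%:R / n%:R) *: h) (iota 0 n.+1)) s).
move=> _ [w [t [Bw /andP[t0 t1] ->]]].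
have [w' w's ww'] := sP w Bw.
have tn0 : 0 <= t * n%:R by rewrite mulr_ge0// ltW.
pose i := Num.truncn (t * n%:R).
have /andP[i1 i2] := truncn_itv tn0.
exists (w' + (i%:R / n%:R) *: h).
  apply/List.in_flat_map; exists w'; split=> //.
  apply/List.in_map_iff; exists i; split=> //.
  have : i \in iota 0 n.+1.
    rewrite mem_iota /= add0n ltnS -(ler_nat R); apply: le_trans i1 _.
    by rewrite ler_piMl// ltW.
  elim: (iota _ _) => //= a l IH.
  by rewrite in_cons => /orP[/eqP->|/IH]; [left|right].
move=> y; rewrite (_ : _ - _ = (w y - w' y) + (t - i%:R / n%:R) * h y); last first.
  rewrite -[(w + t *: h) y]/(w y + t * h y).
  by rewrite -[(w' + _ *: h) y]/(w' y + (i%:R / n%:R) * h y); ring.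
apply: (le_trans (ler_normD _ _)).
suff : `|(t - i%:R / n%:R) * h y| <= d / 2 by have := ww' y; lra.
rewrite normrM (_ : t - _ = (t * n%:R - i%:R) / n%:R); last by field; rewrite gt_eqF.
rewrite normrM normfV (gtr0_norm n0) mulrAC ler_pdivrMr//.
apply: (@le_trans _ _ `|K|); last by rewrite mulrC.
rewrite -[leRHS]mul1r; apply: ler_pM => //.
  by rewrite ger0_norm; move: i2; rewrite -natr1 /i; lra.
exact: le_trans (hK y) (ler_norm _).
Qed.

Section ultrafilter.
Context (H : set WY) (U : set_system WY).
Hypotheses (Hrec : recurrent H) (UU : UltraFilter U) (UH : U H).

(* Otherwise one picks [h_n] in smaller and smaller members of [U], keeping the
   hull of the later ones away from a totally bounded convex set that contains
   the earlier ones; this contradicts recurrence. *)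
Lemma ultra_near_hull (d : R) : 0 < d ->
  exists e : CY, forall A, U A -> exists2 c, conv A c & forall y, `|c y - e y| <= d.
Proof.
move=> d0; apply: contrapT => noe.
have UP : ProperFilter U by exact: ultra_proper.
have far (e : CY) : exists2 A, U A & forall c, conv (A : set CY) c ->
    ~ forall y, `|c y - e y| <= d.
  apply: contrapT => noA; apply: noe; exists e => A UA; apply: contrapT => noc.
  by apply: noA; exists A => // c Ac ce; apply: noc; exists c.
(* The gap [d / 2] leaves room for a finite [d / 2]-net of [B]: a function that is not within [d] of
   any net point is not within [d / 2] of any element of [B]. *)
pose sep (B A : set CY) := forall v c, B v -> conv A c ->
  ~ forall y, `|v y - c y| <= d / 2.
have sepB B : totally_bounded B -> exists2 A, U A & sep B A.
  move=> Btb; have [s sP] := Btb (d / 2) (divr_gt0 d0 (ltr0Sn _ 1)).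
  have [A UA Afar] : exists2 A, U A & forall w, List.In w s ->
      forall c, conv (A : set CY) c -> ~ forall y, `|c y - w y| <= d.
    elim: {sP} s => [|w s [A UA Afar]]; first by exists setT => //; exact: filterT.
    have [A' UA' A'far] := far w; exists (A `&` A'); first exact: filterI.
    move=> z [<-|zs] c cc.
      by apply: A'far; apply: conv_mono cc => x [].
    by apply: Afar => //; apply: conv_mono cc => x [].
  exists A => // v c Bv Ac vc; have [w ws vw] := sP v Bv.
  apply: (Afar w ws c Ac) => y; have := vc y; have := vw y.
  by rewrite !ler_norml; lra.
(* The first component holds the functions chosen so far, the second is the member of [U] from which
   later ones are taken. *)
pose good (s : set CY * set WY) :=
  [/\ totally_bounded s.1, convex_subset s.1, s.1 0 & U s.2].
pose S := {s | good s}.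
have step (s : S) : exists s'h : S * CY, let s' := sval s'h.1 in let h := s'h.2 in
    [/\ H h, s'.2 h, s'.2 `<=` (sval s).2, (sval s).1 `<=` s'.1 &
      s'.1 h /\ sep (sval s).1 s'.2].
  case: s => [[B A] [/= Btb Bc B0 UA]].
  have [A' UA' sepA'] := sepB B Btb.
  have [h [[Hh Ah] A'h]] : H `&` A `&` A' !=set0.
    by apply: (@filter_ex _ U); apply: filterI => //; exact: filterI.
  have gd : good (segment_sum B h, A `&` A').
    split=> /=; [exact: totally_bounded_segment| |exists 0, 0|exact: filterI].
      move=> _ _ t t01 [w [r [Bw r01 ->]]] [w' [r' [Bw' r'01 ->]]].
      exists (t *: w + (1 - t) *: w'), (t * r + (1 - t) * r'); split.
      - exact: Bc.
      - by nra.
      - by rewrite !scalerDr !scalerA addrACA -scalerDl.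
    by split=> //; rewrite ?lexx ?ler01// scale0r addr0.
  exists (exist good _ gd, h); split=> //=.
    by move=> v Bv; exists v, 0; rewrite lexx ler01 scale0r addr0.
  split; first by exists 0, 1; rewrite lexx ler01 scale1r add0r.
  by move=> v c Bv cc; apply: sepA' => //; apply: conv_mono cc => x [].
have [f fP] := choice step.
have g0 : good ([set 0], H).
  split=> //=.
    move=> e e0; exists [:: 0] => _ ->; exists 0 => [|y]; first by left.
    by rewrite subrr normr0 ltW.
  by move=> _ _ t _ -> ->; rewrite !scaler0 addr0.
pose st n := iter n (fun s => (f s).1) (exist good _ g0).
pose h n := (f (st n)).2.
have hH n : H (h n) by have [] := fP (st n).
have mono1 m k : (k < m)%N -> (sval (st m)).1 (h k).
  elim: m => // m IH; rewrite ltnS leq_eqVlt => /orP[/eqP->|/IH km].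
    by have [_ _ _ _ []] := fP (st m).
  by have [_ _ _ + _] := fP (st m); apply.
have mono2 m k : (sval (st (m + k).+1)).2 `<=` (sval (st m.+1)).2.
  elim: k => [|k IH]; first by rewrite addn0.
  apply: subset_trans IH; rewrite addnS.
  by have [_ _ + _ _] := fP (st (m + k).+1); apply.
have d2 : 0 < d / 2 by rewrite divr_gt0.
have [m [c1 [c2 [c1m c2m c12]]]] := Hrec hH d2.
(* The first component at stage [m] contains [c1], and [c2] lies in the hull of the second component
   at stage [m.+1]; [sep] keeps these apart. *)
have [_ _ _ _ [_ sepm]] := fP (st m).
apply: (sepm c1 c2) => //.
  apply: conv_sub c1m; first by move=> _ [k /= km <-]; exact: mono1.
  by have [] := svalP (st m).
apply: conv_mono c2m => _ [k /= mk <-]; rewrite -(subnKC mk).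
apply: (mono2 m (k - m)%N); by have [] := fP (st (m + (k - m))%N).
Qed.

Hypothesis Hbd : exists K : R, forall h y, H h -> `|(h : CY) y| <= K.

(** The pointwise limit [T] along [U] is a uniform limit of the functions given by
    [ultra_near_hull], hence continuous. If some functional failed to converge, the ultrafilter
    would keep its values at a distance on one side of the value at [T]. That side is preserved by
    hulls, which contain functions uniformly near [T]. *)
Lemma ultra_weak_cvg : exists e : WY, U --> e.
Proof.
have UP : ProperFilter U by exact: ultra_proper.
have /choice[T TP] : forall y, exists t, forall e : R, 0 < e ->
    U [set h | `|(h : CY) y - t| <= e].
  move=> y; have [K HK] := Hbd.
  pose G : set_system R^o := (fun h : WY => (h : CY) y : R^o) @ U.
  have GG : ProperFilter G by exact: fmap_proper_filter.
  have GK : G `[- K, K]%classic.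
    by apply: (@filterS _ U _ H) => // h Hh /=; rewrite in_itv /= -ler_norml; exact: HK.
  have [t [_ Gt]] := @segment_compact R (- K) K G GG GK.
  exists t => e e0.
  have [//|UC] := in_ultra_setVsetC [set h | `|(h : CY) y - t| <= e] UU.
  have GC : G [set x | e < `|x - t|].
    by apply: (@filterS _ U _ _ _ _ UC) => h /= /negP; rewrite -ltNge.
  have [x [/= xt]] := Gt _ _ GC (nbhsx_ballx (t : R^o) e e0).
  by rewrite /ball /= distrC => /(lt_trans xt); rewrite ltxx.
have approx (d : R) : 0 < d -> exists e : CY, (forall y, `|e y - T y| <= 2 * d) /\
    forall A, U A -> exists2 c, conv A c & forall y, `|c y - e y| <= d.
  move=> d0; have [e eP] := ultra_near_hull d0; exists e; split=> // y.
  have [c cA ce] := eP _ (TP y d d0).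
  have : `|c y - T y| <= d.
    elim: cA {ce} => [x //|x z t t01 _ xT _ zT].
    move: xT zT; rewrite cts_combE !ler_norml => /andP[? ?] /andP[? ?].
    by apply/andP; split; nra.
  by have := ce y; rewrite !ler_norml; lra.
have Tcts : continuous (T : Y -> R).
  move=> y; apply/cvgrPdist_lt => d d0.
  have d5 : 0 < d / 5 by rewrite divr_gt0.
  have [e [eT _]] := approx _ d5.
  have /cvgrPdist_lt/(_ _ d5) := @cts_fun _ _ e y.
  apply: filterS => z /=; have := eT y; have := eT z.
  by rewrite !ler_norml !ltr_norml; lra.
exists (mkcts Tcts : CY); apply/weak_cvgP => u d d0.
set E : CY := mkcts Tcts.
have [K K0 uK] := dual_lipschitz Ycompact u.
(* With this radius a hull element is within [3 * (d / (4 * K))] of [E], so its value under [u] is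
   off by at most [3 / 4 * d]. *)
have Kd : 0 < d / (4 * K) by rewrite divr_gt0// mulr_gt0.
have [e [eT eP]] := approx _ Kd.
have near_E A : U A -> exists2 c, conv A c & `|u c - u E| < d.
  move=> /eP[c cA ce]; exists c => //.
  apply: (@le_lt_trans _ _ (K * (3 * (d / (4 * K))))).
    apply: uK => [|y]; first by rewrite mulr_ge0// ltW.
    have := ce y; have := eT y; rewrite -[E y]/(T y) !ler_norml; lra.
  rewrite (_ : K * _ = 3 / 4 * d); first lra.
  by field; rewrite gt_eqF.
have [//|UC] := in_ultra_setVsetC [set f | `|u E - u f| < d] UU.
have uconv (A : set CY) (a b : R) c : (forall f, A f -> a <= b * u f) ->
    conv A c -> a <= b * u c.
  move=> Aa; elim=> [x /Aa//|x y t /andP[t0 t1] _ xa _ ya].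
  rewrite linearP linearZ /= mulrDr.
  rewrite -[_ *: _]/(t * u x) -[(1 - t) *: _]/((1 - t) * u y).
  by nra.
have [Up|Um] := in_ultra_setVsetC [set f | u E + d <= u f] UU.
  have [c cc] := near_E _ Up.
  have : u E + d <= 1 * u c by apply: uconv cc => f /=; rewrite mul1r.
  by rewrite mul1r ltr_norml; lra.
have [c cc] := near_E _ (filterI UC Um).
have : d - u E <= - 1 * u c.
  apply: uconv cc => f [/= /negP + /negP]; rewrite -leNgt -ltNge ler_normr.
  by move=> /orP[] ? ?; lra.
by rewrite ltr_norml; lra.
Qed.

End ultrafilter.

Lemma recurrent_precompact (H : set WY) :
  (exists K : R, forall h y, H h -> `|(h : CY) y| <= K) ->
  recurrent H -> precompact H.
Proof.
move=> Hbd Hrec; apply: ultra_precompact; last first.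
  by move=> U UU UH; apply: (ultra_weak_cvg Hrec UU UH Hbd).
pose ev : CY -> {ptws cts_dual R Y -> R^o} := fun f u => u f.
exact: (@uniform_regular (initial_topology ev)).
Qed.

End recurrent_precompact.

(** * Quotients of compact Hausdorff spaces *)

Section closed_quotient.
Local Open Scope quotient_scope.
Context (R : realType) (Y : topologicalType) (F : equiv_rel Y).
Hypotheses (Ycompact : compact [set: Y]) (Yhaus : hausdorff_space Y)
  (Fclosed : closed [set xy : Y * Y | F xy.1 xy.2]).
Local Notation Q := (quotient_topology {eq_quot F}).

Definition qpi : Y -> Q := \pi_Q.

Lemma qpi_eq x y : qpi x = qpi y <-> F x y.
Proof. by split=> [/eqmodP|/eqmodP]. Qed.

Lemma qpi_repr q : qpi (repr q) = q.
Proof. exact: reprK. Qed.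

Lemma qpi_continuous : continuous qpi.
Proof. exact: pi_continuous. Qed.

Lemma quotient_compact : compact [set: Q].
Proof.
have -> : [set: Q] = [set qpi y | y in [set: Y]].
  by apply/seteqP; split=> // q _; exists (repr q) => //; exact: qpi_repr.
apply: continuous_compact => //; apply: continuous_subspaceT.
exact: qpi_continuous.
Qed.

(** The saturation of [A] is the second projection of a compact part of the graph of [F]. *)
Lemma qpi_closed (A : set Y) : closed A -> closed [set qpi y | y in A].
Proof.
move=> Acl.
suff /closed_openC : closed (qpi @^-1` [set qpi y | y in A]).
  by rewrite preimage_setC => Ao; rewrite -openC.
have -> : qpi @^-1` [set qpi y | y in A] =
    [set xy.2 | xy in [set xy : Y * Y | F xy.1 xy.2] `&` (fst @^-1` A)].
  apply/seteqP; split=> [y [x Ax /qpi_eq xy]|_ [[x y] [/= xy Ax] <-]].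
    by exists (x, y).
  by exists x => //; exact/qpi_eq.
apply: compact_closed => //; apply: continuous_compact.
  by apply: continuous_subspaceT => xy; exact: cvg_snd.
apply: (@subclosed_compact _ _ [set: Y * Y]) => //.
  by apply: closedI => //; apply: preimage_closed => // xy _; exact: cvg_fst.
by rewrite -setXTT; exact: compact_setX.
Qed.

Lemma quotient_normal : normal_space Q.
Proof.
apply/(@normal_openP R) => A B Acl Bcl AB0.
have preA : closed (qpi @^-1` A).
  by apply: preimage_closed => // y _; exact: qpi_continuous.
have preB : closed (qpi @^-1` B).
  by apply: preimage_closed => // y _; exact: qpi_continuous.
have /(@normal_openP R) := compact_normal Yhaus Ycompact.
move=> /(_ _ _ preA preB); rewrite -preimage_setI AB0 preimage_set0.
move=> /(_ erefl)[U [V [Uo Vo AU BV UV0]]].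
exists (~` [set qpi y | y in ~` U]), (~` [set qpi y | y in ~` V]); split.
- exact/closed_openC/qpi_closed/open_closedC.
- exact/closed_openC/qpi_closed/open_closedC.
- by move=> q Aq [y /= Uy yq]; apply: Uy; apply: AU; rewrite /preimage/= yq.
- by move=> q Bq [y /= Vy yq]; apply: Vy; apply: BV; rewrite /preimage/= yq.
apply/seteqP; split=> // q [qU qV].
have : (U `&` V) (repr q).
  split; apply: contrapT => nq.
    by apply: qU; exists (repr q) => //; exact: qpi_repr.
  by apply: qV; exists (repr q) => //; exact: qpi_repr.
by rewrite UV0.
Qed.

(** The quotient is normal with closed points, so Urysohn functions separate classes. *)
Lemma quotient_separation x y :
  (forall k : continuousType Q R, k (qpi x) = k (qpi y)) -> F x y.
Proof.
move=> kxy; apply: contrapT => nF.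
have cl1 z : closed [set qpi z].
  rewrite -image_set1; apply: qpi_closed.
  by apply: accessible_closed_set1; apply: hausdorff_accessible.
have xy0 : [set qpi x] `&` [set qpi y] = set0.
  by apply/seteqP; split=> // q [-> /qpi_eq].
have uni := (@normal_separatorP R _).1 quotient_normal _ _ (cl1 x) (cl1 y) xy0.
have [k [kc _ k0 k1]] := (@uniform_separatorP _ R _ _).1 uni.
have E : k (qpi x) = k (qpi y) := kxy (mkcts kc).
have kx : k (qpi x) = 0 by apply: k0; exists (qpi x).
have ky : k (qpi y) = 1 by apply: k1; exists (qpi y).
by move: E; rewrite kx ky => /esym/eqP; rewrite oner_eq0.
Qed.

(** Tietze's theorem on the closed image of [A]. The function to extend is read off through a
    selector, and it is continuous because the projection is a closed map. *)
Lemma quotient_extension (A : set Y) (f : Y -> R) : closed A -> continuous f ->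
  (forall x y, A x -> A y -> F x y -> f x = f y) ->
  exists k : continuousType Q R, forall x, A x -> k (qpi x) = f x.
Proof.
move=> Acl fc fF.
have [M fM] := cts_bounded Ycompact (mkcts fc : continuousType Y R).
pose lift (q : Q) (x : Y) := A x /\ qpi x = q.
have /choice[sel selP] : forall q, exists x, (exists x', lift q x') -> lift q x.
  move=> q; have [[x' x'P]|nx] := pselect (exists x', lift q x').
    by exists x'.
  by exists (repr q).
have sel_pi x : A x -> f (sel (qpi x)) = f x.
  move=> Ax; have [|Asel /qpi_eq selx] := selP (qpi x); first by exists x.
  exact: fF.
pose A' := [set qpi x | x in A].
have A'cl : closed A' by exact: qpi_closed.
have fcl (B : set R) : closed B -> closed [set qpi x | x in A `&` f @^-1` B].
  move=> Bcl; apply: qpi_closed; apply: closedI => //.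
  by apply: preimage_closed => // z _; exact: fc.
have fc' : {within A', continuous (f \o sel : Q -> R^o)}.
  apply/continuous_closedP => B Bcl; apply/closed_subspaceP.
  exists [set qpi x | x in A `&` f @^-1` B]; first exact: fcl.
  apply/seteqP; split=> q.
    move=> [[x [Ax Bx] <-] A'x]; split=> //.
    by change (B (f (sel (qpi x)))); rewrite sel_pi.
  move=> [Bq [x Ax xq]]; split; last by exists x.
  exists x => //; split=> //; change (B (f (sel q))) in Bq.
  by move: Bq; rewrite -xq sel_pi.
have [||k [kf kc _]] := continuous_bounded_extension quotient_normal A'cl
    (M := `|M| + 1) _ fc' _.
- by rewrite ltr_wpDl.
- move=> q _ /=; apply: (le_trans (fM (sel q))).
  by have := ler_norm M; lra.
exists (mkcts kc : continuousType Q R) => x Ax.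
change (k (qpi x) = f x); rewrite -kf; first exact: sel_pi.
by rewrite inE; exists x.
Qed.

End closed_quotient.

Lemma eq_on_closure (R : realType) (Y : topologicalType) (f g : Y -> R)
    (A : set Y) : continuous f -> continuous g -> (forall x, A x -> f x = g x) ->
  forall x, closure A x -> f x = g x.
Proof.
move=> fc gc fg x Ax.
have cl : closed [set x | f x - g x = 0].
  apply: (@preimage_closed _ _ (fun x => f x - g x) [set 0]).
    move=> z _; exact: continuousB (fc z) (gc z).
  exact: (@closed_eq R 0).
apply/eqP; rewrite -subr_eq0; apply/eqP; apply: cl.
by apply: closureS Ax => z Az /=; rewrite fg// subrr.
Qed.

(** * WAP quotient flows *)

Section flow_quotients.
Local Open Scope quotient_scope.
Context (R : realType) (G : groupType) (Y : topologicalType) (phi : flow G Y).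
Hypothesis Ycompact : compact [set: Y].
Context (F : equiv_rel Y) (Finv : invariant_rel phi F).
Local Notation Q := (quotient_topology {eq_quot F}).
Local Notation CQ := (continuousType Q R).
Local Notation tr := (translate (quotient_flow Finv)).

Lemma translate_qpi g (k : CQ) y : tr g k (qpi F y) = k (qpi F (phi g^-1%g y)).
Proof. by congr (k _); exact: quotient_act_pi. Qed.

Lemma flow_actK g y : phi g (phi g^-1%g y) = y.
Proof. by rewrite -flow_actM mulgV flow_act1. Qed.

Lemma wap_flow_of_recurrent :
  (forall k : CQ, recurrent (range (fun g => tr g k))) ->
  wap_flow R (quotient_flow Finv).
Proof.
move=> krec k; apply: recurrent_precompact (krec k).
  exact: quotient_compact.
have [K kK] := cts_bounded (quotient_compact (F := F) Ycompact) k.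
by exists K => _ q [g _ <-]; exact: kK.
Qed.

(** Here [K] is a weakly compact set containing the orbit of [k]. All later limits of translates are
    taken in it, by prescribing values of functionals. *)
Lemma wap_flow_interpolation (k : CQ) : wap_flow R (quotient_flow Finv) ->
  exists K : set (weak_C R Q), [/\ recurrent K, forall g, K (tr g k) &
    forall (Z : Type) (v : Z -> cts_dual R Q) (T : Z -> R),
    (forall (s : seq Z) (e : R), 0 < e ->
       exists g, forall z, List.In z s -> `|v z (tr g k) - T z| < e) ->
    exists2 h, K h & forall z, v z h = T z].
Proof.
move=> /(_ k)[K kK [Kc _]]; have kK' g : K (tr g k) by apply: kK; exists g.
exists K; split=> //.
  by apply: compact_recurrent => //; exact: quotient_compact.
move=> Z v T vT; apply: compact_interpolation => // s e e0.
by have [g gP] := vT s e e0; exists (tr g k).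
Qed.

End flow_quotients.

(** * Transfer along a factor map *)

Section transfer.
Local Open Scope quotient_scope.
Context (R : realType) (G G' : groupType) (Y Y' : topologicalType).
Context (phi : flow G Y) (phi' : flow G' Y').
Context (r : Y' -> Y) (Z : Type) (y : Z -> Y) (y' : Z -> Y') (zact : G -> Z -> Z).
Hypotheses (Ycompact : compact [set: Y]) (Yhaus : hausdorff_space Y)
  (Y'compact : compact [set: Y']) (Y'haus : hausdorff_space Y')
  (rc : continuous r) (ry' : forall z, r (y' z) = y z)
  (ydense : forall p, closure (range y) p)
  (yact : forall g z, phi g (y z) = y (zact g z)).

(** In the application [Z] consists of the tuples of X(C), and [y z] and [y' z] are the types of
    such a tuple over C and over C'. *)
Let D' := closure (range y').

(** The image of [D'] under [r] is compact, hence closed, and contains the dense set [range y]. *)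
Lemma closed_lift p : exists2 p', D' p' & r p' = p.
Proof.
have rD : closed [set r p' | p' in D'].
  apply: compact_closed => //; apply: continuous_compact.
    exact: continuous_subspaceT.
  apply: (subclosed_compact _ Y'compact) => //; exact: closed_closure.
have : [set r p' | p' in D'] p.
  apply: rD.
  suff yD : range y `<=` [set r p' | p' in D'] by exact: (closureS yD (@ydense p)).
  move=> _ [z _ <-].
  by exists (y' z); [apply: subset_closure; exists z|exact: ry'].
by move=> [p' Dp' <-]; exists p'.
Qed.

(** The map [r] is a closed surjection, hence a quotient map. *)
Lemma factor_continuous (f : Y -> R) : continuous (f \o r) -> continuous f.
Proof.
move=> frc; apply/continuous_closedP => B Bcl.
have -> : f @^-1` B = [set r p' | p' in (f \o r) @^-1` B].
  apply/seteqP; split=> [p Bp|_ [p' Bp' <-]//].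
  by have [p' _ rp'] := closed_lift p; exists p'; rewrite // /preimage /= rp'.
apply: compact_closed => //; apply: continuous_compact.
  exact: continuous_subspaceT.
apply: (subclosed_compact _ Y'compact) => //.
by apply: preimage_closed => // z _; exact: frc.
Qed.

(** * Descending a WAP relation from [Y'] to [Y] *)

Section descend.
Hypothesis stabilize : forall (f : Y' -> R) (s : seq Z) (e : R),
  continuous f -> 0 < e -> exists g' : G',
    (forall z, List.In z s -> `|f (phi' g'^-1%g (y' z)) - f (y' z)| < e) /\
    forall p' q', r p' = r q' ->
      `|f (phi' g'^-1%g p') - f (phi' g'^-1%g q')| < e.
Hypothesis imitate : forall (f : Y' -> R) (g : G) (s : seq Z) (e : R),
  continuous f -> 0 < e -> exists g' : G', forall z, List.In z s ->
    `|f (phi' g'^-1%g (y' z)) - f (y' (zact g^-1%g z))| < e.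
Context (F' : equiv_rel Y').
Hypothesis F'wap : wap_quotient_rel R phi' F'.
Local Notation Q' := (quotient_topology {eq_quot F'}).
Local Notation CQ' := (continuousType Q' R).
Local Notation pi' := (qpi F').

Lemma cts_qpi (k : CQ') : continuous (fun p' => k (pi' p') : R).
Proof.
move=> p'; apply: (@continuous_comp _ _ _ pi' k); first exact: qpi_continuous.
exact: cts_fun.
Qed.

(** The evaluations at the points [y' z] are prescribed to be those of [k], and the differences over
    pairs in one fibre of [r] to be [0]. By [stabilize], a single translate of [k] approximately
    meets finitely many of these requirements. *)
Lemma factoring_function (k : CQ') : exists h : CQ',
  (forall p', D' p' -> h (pi' p') = k (pi' p')) /\
  forall p' q', r p' = r q' -> h (pi' p') = h (pi' q').
Proof.
have [F'cl [F'inv F'w]] := F'wap.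
have Q'c : compact [set: Q'] := quotient_compact Y'compact.
have [K [_ _ Kint]] := wap_flow_interpolation Y'compact k F'w.
pose v (x : Z + {pq : Y' * Y' | r pq.1 = r pq.2}) : cts_dual R Q' :=
  match x with
  | inl z => point_dual R Q'c (pi' (y' z))
  | inr pq => pair_dual R Q'c (pi' (sval pq).1) (pi' (sval pq).2)
  end.
pose T (x : Z + {pq : Y' * Y' | r pq.1 = r pq.2}) : R :=
  if x is inl z then k (pi' (y' z)) else 0.
have [s e e0|h _ hP] := Kint _ v T.
  pose sZ := List.flat_map (fun x : Z + {pq : Y' * Y' | r pq.1 = r pq.2} =>
    if x is inl z then [:: z] else [::]) s.
  have [g' [g'Z g'r]] := stabilize sZ (@cts_qpi k) e0.
  exists g' => -[z zs|[[p q] /= pq] _].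
    rewrite -[v (inl z) _]/(translate (quotient_flow F'inv) g' k (pi' (y' z))).
    rewrite translate_qpi; apply: g'Z.
    by apply/List.in_flat_map; exists (inl z); split=> //=; left.
  change (`|(translate (quotient_flow F'inv) g' k (pi' p) -
    translate (quotient_flow F'inv) g' k (pi' q)) - 0| < e).
  by rewrite !translate_qpi subr0; exact: g'r.
exists h; split.
  apply: eq_on_closure; [exact: cts_qpi|exact: cts_qpi|].
  by move=> _ [z _ <-]; exact: (hP (inl z)).
move=> p' q' pq; apply/eqP; rewrite -subr_eq0; apply/eqP.
exact: (hP (inr (exist (fun pq => r pq.1 = r pq.2) (p', q') pq))).
Qed.

Lemma fibre_collapse p' q' : D' p' -> D' q' -> r p' = r q' -> F' p' q'.
Proof.
have [F'cl _] := F'wap.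
move=> Dp Dq pq; apply: (quotient_separation (R := R)) => // k.
have [h [hk hr]] := factoring_function k.
by rewrite -(hk _ Dp) -(hk _ Dq); exact: hr.
Qed.

Variable ch : Y -> Y'.
Hypotheses (chD : forall p, D' (ch p)) (chr : forall p, r (ch p) = p).

Lemma cts_section (k : CQ') : continuous (fun p => k (pi' (ch p)) : R).
Proof.
have [h [hk hr]] := factoring_function k.
have -> : (fun p => k (pi' (ch p)) : R) = fun p => h (pi' (ch p)).
  by apply/funext => p; rewrite hk.
apply: factor_continuous.
have -> : (fun p => h (pi' (ch p)) : R) \o r = fun p' => h (pi' p').
  by apply/funext => p' /=; apply: hr; rewrite chr.
exact: cts_qpi.
Qed.

(** By [imitate], some [h] in the compact set takes the required values at the points [y' z];
    density of [range y] and continuity of both sides do the rest. Translates under [G] are thus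
    controlled by a recurrent set coming from [G']. *)
Lemma translate_section (k : CQ') : exists2 K : set CQ', recurrent K &
  forall g : G, exists2 h, K h &
    forall p, h (pi' (ch p)) = k (pi' (ch (phi g^-1%g p))).
Proof.
have [F'cl [F'inv F'w]] := F'wap.
have Q'c : compact [set: Q'] := quotient_compact Y'compact.
have [K [Krec _ Kint]] := wap_flow_interpolation Y'compact k F'w.
exists K => // g.
pose v (z : Z) : cts_dual R Q' := point_dual R Q'c (pi' (y' z)).
pose T z : R := k (pi' (y' (zact g^-1%g z))).
have [s e e0|h Kh hP] := Kint _ v T.
  have [g' g'Z] := imitate g s (@cts_qpi k) e0.
  exists g' => z zs.
  rewrite -[v z _]/(translate (quotient_flow F'inv) g' k (pi' (y' z))).
  by rewrite translate_qpi; exact: g'Z.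
exists h => // p.
apply: (@eq_on_closure R Y (fun p => h (pi' (ch p)))
  (fun p => k (pi' (ch (phi g^-1%g p)))) (range y)) => //.
- exact: cts_section.
- move=> x; apply: (@continuous_comp _ _ _ (phi g^-1%g) (fun p => k (pi' (ch p)))).
    exact: flow_continuous.
  exact: cts_section.
move=> _ [z _ <-].
have chy w : pi' (ch (y w)) = pi' (y' w).
  apply/qpi_eq; apply: fibre_collapse => //; last by rewrite chr ry'.
  by apply: subset_closure; exists w.
rewrite yact !chy; exact: (hP z).
Qed.

(* Modulo [F'], all lifts in [D'] of a point agree, so [ch] induces a continuous
   map [Y -> Q']; its kernel is a WAP relation on [Y]. *)
Definition section_rel : rel Y := fun p q => F' (ch p) (ch q).

Lemma section_rel_refl : reflexive section_rel.
Proof. by move=> p; exact: generic_quotient.equiv_refl. Qed.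
Lemma section_rel_sym : symmetric section_rel.
Proof. by move=> p q; exact: generic_quotient.equiv_sym. Qed.
Lemma section_rel_trans : transitive section_rel.
Proof. by move=> p q s; exact: generic_quotient.equiv_trans. Qed.

Definition section_equiv : equiv_rel Y :=
  EquivRel section_rel section_rel_refl section_rel_sym section_rel_trans.

Lemma section_equivP p q :
  (forall k : CQ', k (pi' (ch p)) = k (pi' (ch q))) <-> section_equiv p q.
Proof.
have [F'cl _] := F'wap; split=> [kpq|pq k]; last first.
  by have -> : pi' (ch p) = pi' (ch q) by exact/qpi_eq.
change (is_true (F' (ch p) (ch q))).
exact: (quotient_separation Y'compact Y'haus F'cl kpq).
Qed.

(** A continuous [f] on the quotient, composed with [r], respects [F'] on [D'] by [fibre_collapse],
    so it extends to some [k] on the quotient by [F']. The translates of [f] are then pulled back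
    from the recurrent set that [translate_section] attaches to [k]. *)
Lemma section_equiv_wap : wap_quotient_rel R phi section_equiv.
Proof.
have [F'cl [F'inv F'w]] := F'wap.
split.
  have -> : [set xy : Y * Y | section_equiv xy.1 xy.2] = \bigcap_(k : CQ')
      [set xy | k (pi' (ch xy.1)) - k (pi' (ch xy.2)) = 0].
    apply/seteqP; split=> [xy /section_equivP kxy k _|xy kxy] /=.
      by rewrite kxy subrr.
    by apply/section_equivP => k; apply/eqP; rewrite -subr_eq0; apply/eqP/kxy.
  apply: closed_bigI => k _.
  apply: (@preimage_closed _ _
    (fun xy : Y * Y => k (pi' (ch xy.1)) - k (pi' (ch xy.2))) [set 0]).
    move=> xy _.
    have c1 : {for xy, continuous (fun xy : Y * Y => k (pi' (ch xy.1)) : R)}.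
      apply: (@continuous_comp _ _ _ fst (fun p => k (pi' (ch p)))).
        exact: cvg_fst.
      exact: cts_section.
    have c2 : {for xy, continuous (fun xy : Y * Y => k (pi' (ch xy.2)) : R)}.
      apply: (@continuous_comp _ _ _ snd (fun p => k (pi' (ch p)))).
        exact: cvg_snd.
      exact: cts_section.
    exact: continuousB c1 c2.
  exact: (@closed_eq R 0).
have Einv : invariant_rel phi section_equiv.
  move=> g p q /section_equivP pq; apply/section_equivP => k.
  have [K _ /(_ g^-1%g)[h _ hP]] := translate_section k.
  by have := hP p; have := hP q; rewrite invgK => <- <-; exact: pq.
exists Einv; apply: wap_flow_of_recurrent => // f.
have fc : continuous (fun p' => f (qpi section_equiv (r p')) : R).
  move=> p'; apply: (@continuous_comp _ _ _ r (fun p => f (qpi section_equiv p))).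
    exact: rc.
  apply: (@continuous_comp _ _ _ (qpi section_equiv) f).
    exact: qpi_continuous.
  exact: cts_fun.
have [|k kf] := quotient_extension Y'compact Y'haus F'cl
    (@closed_closure _ (range y')) fc.
  move=> p' q' Dp Dq pq; congr (f _); apply/qpi_eq.
  change (is_true (F' (ch (r p')) (ch (r q')))).
  apply: (@generic_quotient.equiv_trans _ F' p').
    by apply: fibre_collapse => //; rewrite chr.
  apply: (@generic_quotient.equiv_trans _ F' q') => //.
  by apply: fibre_collapse => //; rewrite chr.
have kfE p : k (pi' (ch p)) = f (qpi section_equiv p).
  by have := kf (ch p) (@chD p); rewrite /= chr.
have [K Krec Kk] := translate_section k.
apply: recurrent_transfer Krec _ => h' h'E.
have /choice[g gP] : forall n, exists g, translate (quotient_flow Einv) g f = h' n.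
  by move=> n; have [g _ gh] := h'E n; exists g.
have /choice[h hP] : forall n, exists h, K h /\
    forall p, h (pi' (ch p)) = k (pi' (ch (phi (g n)^-1%g p))).
  by move=> n; have [h Kh hk] := Kk (g n); exists h.
exists h, (fun q => pi' (ch (repr q))); split=> [n|n q].
  by have [] := hP n.
have [_ ->] := hP n.
by rewrite kfE -gP -{1}(qpi_repr q) translate_qpi.
Qed.

End descend.

(** By minimality [F] is contained in the kernel [section_equiv], so chosen lifts in [D'] of
    [F]-equivalent points are [F']-equivalent. *)
Lemma F_WAP_lift (F : equiv_rel Y) (F' : equiv_rel Y') :
  (forall (f : Y' -> R) (s : seq Z) (e : R), continuous f -> 0 < e ->
    exists g' : G',
    (forall z, List.In z s -> `|f (phi' g'^-1%g (y' z)) - f (y' z)| < e) /\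
    forall p' q', r p' = r q' ->
      `|f (phi' g'^-1%g p') - f (phi' g'^-1%g q')| < e) ->
  (forall (f : Y' -> R) (g : G) (s : seq Z) (e : R), continuous f -> 0 < e ->
    exists g' : G', forall z, List.In z s ->
    `|f (phi' g'^-1%g (y' z)) - f (y' (zact g^-1%g z))| < e) ->
  is_F_WAP R phi F -> wap_quotient_rel R phi' F' ->
  forall p q, F p q -> exists p' q', [/\ F' p' q', r p' = p & r q' = q].
Proof.
move=> stabilize imitate [_ Fmin] F'wap p q Fpq.
have /choice[ch chP] : forall p, exists p', D' p' /\ r p' = p.
  by move=> x; have [x' Dx' <-] := closed_lift x; exists x'.
have chD x : D' (ch x) by have [] := chP x.
have chr x : r (ch x) = x by have [] := chP x.
have Ewap := section_equiv_wap stabilize imitate F'wap chD chr.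
by exists (ch p), (ch q); split=> //; exact: (Fmin _ Ewap _ _ Fpq).
Qed.

(** * Lifting a WAP relation from [Y] to [Y'] *)

Section ascend.
Hypothesis pull_back : forall (f : Y -> R) (s' : G') (s : seq Z) (e : R),
  continuous f -> 0 < e -> exists g : G, forall z, List.In z s ->
    `|f (phi g^-1%g (y z)) - f (r (phi' s' (y' z)))| < e.
Hypothesis small_support : forall f' : Y' -> R, continuous f' ->
  exists (s' : G') (f : Y -> R), (forall p', f' p' = f (r (phi' s' p'))) /\
    forall t' : nat -> G', exists (t : nat -> G) (rho : Y' -> Y'),
    forall n p', f (r (phi' (t' n) p')) = f (phi (t n)^-1%g (r (rho p'))).
Context (F : equiv_rel Y).
Hypothesis Fwap : wap_quotient_rel R phi F.
Local Notation Q := (quotient_topology {eq_quot F}).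
Local Notation CQ := (continuousType Q R).

(** This is the largest invariant relation inside the preimage of [F] under [r]. *)
Definition hull_rel : rel Y' :=
  fun p' q' => `[< forall s', F (r (phi' s' p')) (r (phi' s' q')) >].

Lemma hull_rel_refl : reflexive hull_rel.
Proof. by move=> p'; apply/asboolP => s'; exact: generic_quotient.equiv_refl. Qed.
Lemma hull_rel_sym : symmetric hull_rel.
Proof.
by move=> p' q'; apply/asboolP/asboolP => pq s';
  rewrite generic_quotient.equiv_sym.
Qed.
Lemma hull_rel_trans : transitive hull_rel.
Proof.
move=> q' p' o' /asboolP pq /asboolP qo; apply/asboolP => s'.
exact: generic_quotient.equiv_trans (pq s') (qo s').
Qed.

Definition hull_equiv : equiv_rel Y' :=
  EquivRel hull_rel hull_rel_refl hull_rel_sym hull_rel_trans.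

(** On [D'] the condition at [s' = 1] implies all others: by [pull_back], the function [k o r o s']
    agrees there with [h o r] for some continuous [h] on the quotient by [F]. *)
Lemma hull_equiv_closed p' q' : D' p' -> D' q' -> F (r p') (r q') ->
  hull_equiv p' q'.
Proof.
have [Fcl [Finv Fw]] := Fwap.
have Qc : compact [set: Q] := quotient_compact Ycompact.
move=> Dp Dq pq; apply/asboolP => s'.
apply: (quotient_separation (R := R)) => // k.
have kc : continuous (fun p => k (qpi F p) : R).
  move=> p; apply: (@continuous_comp _ _ _ (qpi F) k); first exact: qpi_continuous.
  exact: cts_fun.
have [K [_ _ Kint]] := wap_flow_interpolation Ycompact k Fw.
pose v (z : Z) : cts_dual R Q := point_dual R Qc (qpi F (y z)).
pose T z : R := k (qpi F (r (phi' s' (y' z)))).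
have [s e e0|h Kh hP] := Kint _ v T.
  have [g gZ] := pull_back s' s kc e0.
  exists g => z zs.
  rewrite -[v z _]/(translate (quotient_flow Finv) g k (qpi F (y z))).
  by rewrite translate_qpi; exact: gZ.
have hD x : D' x -> h (qpi F (r x)) = k (qpi F (r (phi' s' x))).
  apply: (@eq_on_closure R Y' (fun x => h (qpi F (r x)))
    (fun x => k (qpi F (r (phi' s' x))))).
  - move=> z; apply: (@continuous_comp _ _ _ r (fun p => h (qpi F p))).
      exact: rc.
    apply: (@continuous_comp _ _ _ (qpi F) h); first exact: qpi_continuous.
    exact: cts_fun.
  - move=> z; apply: (@continuous_comp _ _ _ (phi' s') (fun x => k (qpi F (r x)))).
      exact: flow_continuous.
    apply: (@continuous_comp _ _ _ r (fun p => k (qpi F p))); first exact: rc.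
    exact: kc.
  by move=> _ [z _ <-]; rewrite ry'; exact: (hP z).
by rewrite -!hD//; congr (h _); exact/qpi_eq.
Qed.

(** By [small_support] a continuous [f'] on the quotient is [f o r] after a translation. Lifting
    points to [D'] shows that [f] respects [F], so it comes from some [k] on the quotient of [Y].
    Any sequence of translates of [f'] is pulled back from translates of [k] along a single map
    built from [rho]. *)
Lemma hull_equiv_wap : wap_quotient_rel R phi' hull_equiv.
Proof.
have [Fcl [Finv Fw]] := Fwap.
split.
  have -> : [set xy : Y' * Y' | hull_equiv xy.1 xy.2] = \bigcap_(s' : G')
      ((fun xy => (r (phi' s' xy.1), r (phi' s' xy.2))) @^-1`
        [set xy : Y * Y | F xy.1 xy.2]).
    apply/seteqP; split=> [xy /asboolP kxy k _|xy kxy]; first exact: kxy.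
    by apply/asboolP => s'; exact: kxy.
  apply: closed_bigI => s' _; apply: preimage_closed => // xy _.
  have rs : continuous (fun x => r (phi' s' x)).
    move=> x; apply: (@continuous_comp _ _ _ (phi' s') r); last exact: rc.
    exact: flow_continuous.
  apply: cvg_pair.
    by apply: (@continuous_comp _ _ _ fst (fun x => r (phi' s' x)));
      [exact: cvg_fst|exact: rs].
  by apply: (@continuous_comp _ _ _ snd (fun x => r (phi' s' x)));
    [exact: cvg_snd|exact: rs].
have Einv : invariant_rel phi' hull_equiv.
  move=> g p q /asboolP pq; apply/asboolP => s'.
  by rewrite -!flow_actM; exact: pq.
exists Einv; apply: wap_flow_of_recurrent => // f'.
have f'c : continuous (fun p' => f' (qpi hull_equiv p') : R).
  move=> p'; apply: (@continuous_comp _ _ _ (qpi hull_equiv) f').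
    exact: qpi_continuous.
  exact: cts_fun.
have [s' [f [f'f ft]]] := small_support f'c.
have frE p' : f (r p') = f' (qpi hull_equiv (phi' s'^-1%g p')).
  by rewrite f'f flow_actK.
have fc : continuous f.
  apply: factor_continuous.
  have -> : f \o r = (fun p' => f' (qpi hull_equiv (phi' s'^-1%g p'))).
    by apply/funext => p' /=; exact: frE.
  move=> x.
  apply: (@continuous_comp _ _ _ (phi' s'^-1%g) (fun p => f' (qpi hull_equiv p))).
    exact: flow_continuous.
  exact: f'c.
have fF p q : F p q -> f p = f q.
  have [p' Dp <-] := closed_lift p; have [q' Dq <-] := closed_lift q => pq.
  rewrite !frE; congr (f' _); apply/qpi_eq; apply: Einv.
  exact: hull_equiv_closed.
have reprF p : f (repr (qpi F p)) = f p.
  by apply: fF; apply/qpi_eq; exact: qpi_repr.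
have kc : continuous (f \o repr : Q -> R).
  apply/quotient_continuous.
  have -> : (f \o repr : Q -> R) \o \pi_Q = f.
    by apply/funext => p; exact: reprF.
  exact: fc.
pose k : CQ := mkcts kc.
have kE p : k (qpi F p) = f p by exact: reprF.
have [K [Krec Kk _]] := wap_flow_interpolation Ycompact k Fw.
apply: recurrent_transfer Krec _ => h' h'E.
have /choice[g gP] : forall n, exists g,
    translate (quotient_flow Einv) g f' = h' n.
  by move=> n; have [g _ gh] := h'E n; exists g.
(* As [f' = f o r o s'], translating [f'] by [g n] amounts to applying [f o r] after
   [s' * (g n)^-1]. *)
have [t [rho trho]] := ft (fun n => s' * (g n)^-1)%g.
exists (fun n => translate (quotient_flow Finv) (t n) k).
exists (fun q => qpi F (r (rho (repr q)))); split=> [n|n q]; first exact: Kk.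
rewrite translate_qpi kE -trho flow_actM -f'f -gP.
by rewrite -{1}(qpi_repr q) translate_qpi.
Qed.

Lemma F_WAP_restrict (F' : equiv_rel Y') : is_F_WAP R phi' F' ->
  forall p' q', F' p' q' -> F (r p') (r q').
Proof.
move=> [_ F'min] p' q' /(F'min _ hull_equiv_wap) /asboolP /(_ 1%g).
by rewrite !flow_act1.
Qed.

End ascend.

End transfer.

(** * Formulas and parameters *)

Lemma card_le_inj (T U : Type) (A : set T) (f : T -> U) :
  (forall x y, A x -> A y -> f x = f y -> x = y) -> (A #<= [set: U])%card.
Proof.
move=> finj.
have finj' : {in A &, injective f}.
  by move=> x y; rewrite !inE => Ax Ay; exact: finj.
have ff : set_fun A [set: U] f by [].
pose g : {injfun A >-> [set: U]} :=
  HB.pack f (isFun.Build T U A [set: U] f ff) (Inj.Build T U A f finj').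
exact: (inj_card_le g).
Qed.

Lemma finite_set_list (T : Type) (A : set T) : finite_set A ->
  exists l : seq T, forall x, List.In x l <-> A x.
Proof.
case=> n; elim: n A => [A|n IH A /eq_cardSP[x Ax /IH[l lP]]].
  by rewrite II0 card_eq0 => /eqP ->; exists [::].
exists (x :: l) => y /=; rewrite lP; split=> [[<-//|[]//]|Ay].
by have [->|xy] := pselect (y = x); [left|right].
Qed.

Lemma list_enum (T : Type) (l : seq T) : inhabited T ->
  exists d : nat -> T, forall x, List.In x l -> exists n, d n = x.
Proof.
move=> [x0]; exists (fun n => List.nth n l x0) => x.
by move=> /(List.In_nth _ _ x0)[n [_ <-]]; exists n.
Qed.

Section formulas.
Context (L : language).

Lemma term_support (V : Type) (t : term L V) : exists s : set V, finite_set s /\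
  forall (W : Type) (h k : V -> W), (forall x, s x -> h x = k x) ->
    trename h t = trename k t.
Proof.
elim: t => [x|f ts IH] /=.
  exists [set x]; split=> [|W h k hk]; first exact: finite_set1.
  by rewrite /= hk.
have [s sP] := choice IH.
exists (\bigcup_i s i); split.
  by apply: bigcup_finite => // i _; have [] := sP i.
move=> W h k hk; congr App; apply/funext => i; have [_] := sP i; apply=> x sx.
by apply: hk; exists i.
Qed.

(** Support is taken syntactically here, so it is independent of any structure and applies to
    renamings into the elements of any model. *)
Lemma formula_support (V : Type) (phi : formula L V) :
  exists s : set V, finite_set s /\
  forall (W : Type) (h k : V -> W), (forall x, s x -> h x = k x) ->
    rename h phi = rename k phi.
Proof.
elim: phi => {V} [V t u|V r ts|V|V phi [s [fs sP]] psi [s' [fs' sP']]|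
    V phi [s [fs sP]]] /=.
- have [s [fs sP]] := term_support t; have [s' [fs' sP']] := term_support u.
  exists (s `|` s'); split; first by rewrite finite_setU.
  move=> W h k hk; rewrite (sP W h k) ?(sP' W h k) //.
    by move=> x ?; apply: hk; right.
  by move=> x ?; apply: hk; left.
- have [s sP] := choice (fun i => term_support (ts i)).
  exists (\bigcup_i s i); split.
    by apply: bigcup_finite => // i _; have [] := sP i.
  move=> W h k hk; congr Rel; apply/funext => i; have [_] := sP i; apply=> x sx.
  by apply: hk; exists i.
- by exists set0.
- exists (s `|` s'); split; first by rewrite finite_setU.
  move=> W h k hk; rewrite (sP W h k) ?(sP' W h k) //.
    by move=> x ?; apply: hk; right.
  by move=> x ?; apply: hk; left.
- exists (Some @^-1` s); split.
    by apply: finite_preimage => // x y _ _ [].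
  move=> W h k hk; congr All; apply: sP => -[y|] //= sy.
  by rewrite hk.
Qed.

(** Renaming variables to elements lets syntactic support control satisfaction. *)
Lemma sat_id_rename (M : structure L) (V : Type) (v : V -> M) (phi : formula L V) :
  sat v phi <-> sat id (rename v phi).
Proof. by rewrite sat_rename. Qed.

(* [psi] mentions no variable [inl i] with [i] outside the list [J]. *)
Definition var_support (I P : Type) (J : seq I) (psi : formula L (I + P)) :=
  forall (W : Type) (h k : I + P -> W),
    (forall i, List.In i J -> h (inl i) = k (inl i)) ->
    (forall n, h (inr n) = k (inr n)) -> rename h psi = rename k psi.

Lemma sat_var_support (M : structure L) (I P : Type) (J : seq I)
    (psi : formula L (I + P)) (a b : I -> M) (c : P -> M) : var_support J psi ->
  (forall i, List.In i J -> a i = b i) ->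
  sat (assign a c) psi <-> sat (assign b c) psi.
Proof.
move=> psiJ ab; rewrite sat_id_rename [X in _ <-> X]sat_id_rename.
by rewrite (psiJ _ (assign a c) (assign b c)).
Qed.

(** Supports are finite, so one sequence [d] and one list [J] serve all formulas of [l]. Sequences
    are the form in which parameters are later moved between models. *)
Lemma extract_parameters (M : Type) (I : Type) (l : seq (formula L (I + M))) :
  inhabited M -> exists (J : seq I) (d : nat -> M), forall phi, List.In phi l ->
  exists2 psi : formula L (I + nat), phi = rename (inr_map d) psi & var_support J psi.
Proof.
move=> M0.
have [S SP] : exists S : seq (I + M), forall phi, List.In phi l ->
    forall (W : Type) (h k : I + M -> W), (forall x, List.In x S -> h x = k x) ->
    rename h phi = rename k phi.
  elim: l => [|phi l [S SP]]; first by exists [::].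
  have [s [/finite_set_list[S' S'P] sP]] := formula_support phi.
  exists (S' ++ S) => psi [<-|psil] W h k hk.
    by apply: sP => x sx; apply: hk; apply/List.in_app_iff; left; apply/S'P.
  by apply: SP => // x xS; apply: hk; apply/List.in_app_iff; right.
pose J := List.flat_map (fun x : I + M => if x is inl i then [:: i] else [::]) S.
pose D := List.flat_map (fun x : I + M => if x is inr c then [:: c] else [::]) S.
have [d dP] := list_enum D M0.
have /choice[idx idxP] : forall c, exists n, List.In c D -> d n = c.
  move=> c; have [/dP[n dn]|nc] := pselect (List.In c D); first by exists n.
  by exists 0%N.
exists J, d => phi phil; exists (rename (inr_map idx) phi).
  rewrite rename_comp -[LHS]rename_id; apply: SP => // -[i|c] //= cS.
  rewrite idxP//; apply/List.in_flat_map; exists (inr c); split=> //.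
  by left.
move=> W h k hJ hk; rewrite !rename_comp; apply: SP => // -[i|c] //= xS.
apply: hJ; apply/List.in_flat_map; exists (inl i); split=> //; by left.
Qed.

End formulas.

(** * Type spaces *)

Section type_topology.
Context (L : language) (M : structure L) (I : Type) (pi : set (formula L I)).
Local Notation S := (type_space M pi).
Implicit Types (p q : S) (phi : formula L (I + M)).

Lemma type_neg p phi : p (Neg phi) <-> ~ p phi.
Proof.
split=> [pN pP|nP]; last by have [|] := type_complete p phi.
have [||a aP] := @type_finsat _ _ _ _ p [set phi; Neg phi].
- exact: finite_set2.
- by move=> psi [->|->].
have /= H := aP phi (or_introl erefl).
by have /= := aP (Neg phi) (or_intror erefl); exact.
Qed.

Lemma open_formula phi : open [set p : S | p phi].
Proof.
exists [set [set p : S | p phi]]; last by rewrite bigcup_set1.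
move=> _ ->; exists [fset phi]%fset; first by move=> ? _; rewrite inE.
apply/seteqP; split=> [p pP|p pP psi]; first by apply: pP => /=; rewrite inE.
by rewrite /= inE => /eqP->.
Qed.

Lemma nbhs_type p (A : set S) : nbhs p A -> exists s : {fset formula L (I + M)},
  (forall phi, phi \in s -> p phi) /\
  forall q, (forall phi, phi \in s -> q phi) -> A q.
Proof.
rewrite nbhsE => -[B [[D DI <-] [C DC Cp]] BA].
have [s _ sC] := DI _ DC; exists s; split.
  by move=> phi phis; move: Cp; rewrite -sC; apply.
move=> q qs; apply: BA; exists C => //.
by change (C q); rewrite -sC => phi phis; exact: qs.
Qed.

Lemma type_space_hausdorff : hausdorff_space S.
Proof.
move=> p q pq; apply: type_space_eq => phi; split=> [pphi|qphi].
  apply: contrapT => /type_neg qN.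
  have [u [oP /type_neg oN]] := pq _ _
    (open_nbhs_nbhs (conj (open_formula phi) pphi))
    (open_nbhs_nbhs (conj (open_formula (Neg phi)) qN)).
  exact: oN.
apply: contrapT => /type_neg pN.
have [u [/type_neg oN oP]] := pq _ _
  (open_nbhs_nbhs (conj (open_formula (Neg phi)) pN))
  (open_nbhs_nbhs (conj (open_formula phi) qphi)).
exact: oN.
Qed.

(** An ultrafilter [U] converges to the type of all [phi] whose basic open set belongs to [U]. *)
Lemma type_space_compact : compact [set: S].
Proof.
rewrite compact_ultra => U UU _.
have UP : ProperFilter U by exact: ultra_proper.
pose t phi := U [set p : S | p phi].
have tfin : finsat (fun c : M => c) t.
  move=> q /finite_fsetP[s ->] st.
  have : U (\bigcap_(phi in [set` s]) [set p : S | p phi]).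
    by apply: filter_bigI => phi phis; exact: st.
  move=> /filter_ex[p pP].
  apply: (@type_finsat _ _ _ _ p) => [|phi phis]; last exact: pP.
  by apply/finite_fsetP; exists s.
have tcompl phi : t phi \/ t (Neg phi).
  have [|UN] := in_ultra_setVsetC [set p : S | p phi] UU; first by left.
  by right; apply: filterS UN => p /= /type_neg.
have text (phi : formula L I) : pi phi -> t (rename inl phi).
  by move=> piphi; apply: filterS filterT => p _; exact: type_extends.
exists (TypeSpace tfin tcompl text); split=> // A /nbhs_type[s [sp sA]].
have : U (\bigcap_(phi in [set` s]) [set p : S | p phi]).
  by apply: filter_bigI => phi phis; exact: sp.
by apply: filterS => q qP; apply: sA => phi phis; exact: qP.
Qed.

(** Otherwise the pairs of types that agree on a finite list, with values at least [e] apart, form a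
    filter base. A cluster point [(p, q)] has [p = q], against continuity of [f] at [p]. *)
Lemma finite_determination (R : realType) (f : S -> R) (e : R) : continuous f ->
  0 < e -> exists l : seq (formula L (I + M)), forall p q,
    (forall phi, List.In phi l -> p phi <-> q phi) -> `|f p - f q| < e.
Proof.
move=> fc e0; apply: contrapT => nol.
pose B (l : seq (formula L (I + M))) := [set pq : S * S |
  (forall phi, List.In phi l -> pq.1 phi <-> pq.2 phi) /\
  e <= `|f pq.1 - f pq.2|].
pose F := filter_from setT B.
have FF : ProperFilter F.
  apply: filter_from_proper; last first.
    move=> l _; apply: contrapT => Bl; apply: nol; exists l => p q pq.
    rewrite ltNge; apply/negP => epq; apply: Bl; by exists (p, q).
  apply: filter_from_filter; first by exists [::].
  move=> l l' _ _; exists (l ++ l') => // pq [pqP epq].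
  by split; split=> // phi phil; apply: pqP; apply/List.in_app_iff; [left|right].
have FT : F ([set: S] `*` [set: S]) by exists [::].
have [[p q] [_ Fpq]] :=
  compact_setX type_space_compact type_space_compact FF FT.
have pq : p = q.
  apply: type_space_eq => phi.
  have FB : F (B [:: phi]) by exists [:: phi].
  have [ph|nph] := pselect (p phi); have [qh|nqh] := pselect (q phi) => //.
    have N : nbhs (p, q) ([set p : S | p phi] `*` [set p : S | p (Neg phi)]).
      exists ([set p : S | p phi], [set p : S | p (Neg phi)]) => //; split=> /=.
        exact: (open_nbhs_nbhs (conj (open_formula phi) ph)).
      apply: (open_nbhs_nbhs (conj (open_formula (Neg phi)) _)).
      exact/type_neg.
    have [[u u'] [[/= oo' _] [/= oP /type_neg oN]]] := Fpq _ _ FB N.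
    by case: oN; apply/(oo' phi (or_introl erefl)).
  have N : nbhs (p, q) ([set p : S | p (Neg phi)] `*` [set p : S | p phi]).
    exists ([set p : S | p (Neg phi)], [set p : S | p phi]) => //; split=> /=.
      apply: (open_nbhs_nbhs (conj (open_formula (Neg phi)) _)).
      exact/type_neg.
    exact: (open_nbhs_nbhs (conj (open_formula phi) qh)).
  have [[u u'] [[/= oo' _] [/= /type_neg oN oP]]] := Fpq _ _ FB N.
  by case: oN; apply/(oo' phi (or_introl erefl)).
have e2 : 0 < e / 2 by rewrite divr_gt0.
have N1 : nbhs p [set u | `|f p - f u| < e / 2].
  by have /cvgrPdist_lt/(_ _ e2) := fc p.
have N : nbhs (p, q) ([set u | `|f p - f u| < e / 2] `*`
    [set u | `|f p - f u| < e / 2]).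
  exists ([set u | `|f p - f u| < e / 2], [set u | `|f p - f u| < e / 2]) => //.
  by split=> //=; rewrite -pq.
have FB : F (B [::]) by exists [::].
have [[u u'] [[/= _ oo'] [/= op o'p]]] := Fpq _ _ FB N.
by move: oo' op o'p; rewrite ler_normr !ltr_norml => /orP[]; lra.
Qed.

Lemma variable_determination (R : realType) (f : S -> R) (e : R) :
  continuous f -> 0 < e -> exists (J : seq I) (d : nat -> M), forall p q,
    (forall psi : formula L (I + nat), var_support J psi ->
       p (rename (inr_map d) psi) <-> q (rename (inr_map d) psi)) ->
    `|f p - f q| < e.
Proof.
move=> fc e0; have [l lP] := finite_determination fc e0.
have [J [d JdP]] := extract_parameters l (carrier_inhabited M).
exists J, d => p q pq; apply: lP => phi /JdP[psi -> psiJ]; exact: pq.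
Qed.

(** The parameter sequences for the accuracies [n.+1%:R^-1] are interleaved into one through a
    coding of pairs. *)
Lemma countable_determination (R : realType) (f : S -> R) : continuous f ->
  exists c : nat -> M, forall p q, (forall psi : formula L (I + nat),
    p (rename (inr_map c) psi) <-> q (rename (inr_map c) psi)) -> f p = f q.
Proof.
move=> fc.
have /choice[d dP] : forall n, exists d : nat -> M, forall p q,
    (forall psi : formula L (I + nat),
       p (rename (inr_map d) psi) <-> q (rename (inr_map d) psi)) ->
    `|f p - f q| < n.+1%:R^-1.
  move=> n; have n0 : 0 < n.+1%:R^-1 :> R by rewrite invr_gt0.
  have [J [d dP]] := variable_determination fc n0.
  by exists d => p q pq; apply: dP => psi _; exact: pq.
pose c (k : nat) : M :=
  if (choice.unpickle k : option (nat * nat)) is Some (n, m) then d n m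
  else d 0%N 0%N.
exists c => p q pq.
have small n : `|f p - f q| < n.+1%:R^-1.
  apply: dP => psi.
  have := pq (rename (inr_map (fun m => choice.pickle (n, m))) psi).
  rewrite rename_comp (_ : inr_map c \o _ = inr_map (d n))//.
  by apply/funext => -[//|m] /=; rewrite /c choice.pickleK.
apply/eqP; rewrite -subr_eq0 -normr_le0; apply/ler_addgt0Pr => e e0.
rewrite add0r ltW//; apply: lt_trans (small (Num.bound e^-1)) _.
rewrite invf_plt ?posrE//; apply: lt_le_trans (archi_boundP _) _.
  by rewrite invr_ge0 ltW.
by rewrite ler_nat.
Qed.

Definition realized_type (a : I -> M)
  (ha : forall phi : formula L I, pi phi -> sat a phi) : S.
Proof.
exists [set phi | sat (assign a (fun c : M => c)) phi].
- by move=> q _ qa; exists a.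
- by move=> phi; exact: (EM (sat _ phi)).
- by move=> phi piphi /=; rewrite sat_rename; exact: ha.
Defined.

Lemma realized_typeE a ha (d : nat -> M) psi :
  @realized_type a ha (rename (inr_map d) psi) <-> sat (assign a d) psi.
Proof.
rewrite /= sat_rename (_ : _ \o _ = assign a d)//.
by apply/funext => -[].
Qed.

Lemma type_actE (g : aut M) p (d : nat -> M) psi :
  type_flow M pi g p (rename (inr_map d) psi) <->
  p (rename (inr_map (aut_inv g \o d)) psi).
Proof.
rewrite /= rename_comp (_ : _ \o _ = inr_map (aut_inv g \o d))//.
by apply/funext => -[].
Qed.

Lemma type_actVE (g : aut M) p (d : nat -> M) psi :
  type_flow M pi g^-1%g p (rename (inr_map d) psi) <->
  p (rename (inr_map (g \o d)) psi).
Proof. by rewrite type_actE. Qed.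

End type_topology.

Lemma elementary_sat (L : language) (M N : structure L) (j : M -> N) (V : Type)
    (v : V -> M) (phi : formula L V) : elementary j ->
  sat v phi <-> sat (j \o v) phi.
Proof.
by move=> jel; rewrite sat_id_rename -(sat_rename v j) -jel.
Qed.

Lemma type_restrE (L : language) (M N : structure L) (j : M -> N)
    (jel : elementary j) (I : Type) (pi : set (formula L I))
    (p : type_space N pi) (d : nat -> M) psi :
  type_restr jel p (rename (inr_map d) psi) <-> p (rename (inr_map (j \o d)) psi).
Proof.
rewrite /= rename_comp (_ : _ \o _ = inr_map (j \o d))//.
by apply/funext => -[].
Qed.

Lemma type_restr_continuous (L : language) (M N : structure L) (j : M -> N)
    (jel : elementary j) (I : Type) (pi : set (formula L I)) :
  continuous (@type_restr L M N j jel I pi).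
Proof.
move=> p A /nbhs_type[s [sp sA]].
have : nbhs p (\bigcap_(phi in [set` s])
    [set p : type_space N pi | p (rename (inr_map j) phi)]).
  apply: filter_bigI => phi phis; apply: open_nbhs_nbhs.
  by split; [exact: open_formula|exact: sp].
by apply: filterS => q qP; apply: sA => phi phis; exact: qP.
Qed.

(** The injection [e] makes the range of [c] small enough for homogeneity. Sending entries of [c] to
    entries of [d] is well defined, since equality of two entries is expressed by a formula. *)
Lemma tuple_homogeneous (L : language) (M : structure L) (I K : Type)
    (e : K -> nat) (c d : K -> M) : succ_strongly_homogeneous M (nat + I) ->
  injective e -> (forall phi : formula L K, sat c phi <-> sat d phi) ->
  exists g : aut M, forall k, g (c k) = d k.
Proof.
move=> Mhom einj cd.
have /choice[sec secP] : forall x : set_type (range c), exists k, c k = val x.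
  by move=> x; have [k _ kx] := set_valP x; exists k.
have Acard : (range c #<= [set: nat + I])%card.
  have [k0|nk] := pselect (exists k : K, True); last first.
    rewrite (_ : range c = set0); first exact: card_ge0.
    by apply/seteqP; split=> // x [k _ _]; apply: nk; exists k.
  have [k0' _] := k0.
  have /choice[sec' sec'P] : forall x, exists k, range c x -> c k = x.
    move=> x; have [[k _ kx]|nx] := pselect (range c x); first by exists k.
    by exists k0'.
  apply: (@card_le_inj _ _ _ (fun x => inl (e (sec' x)))) => x y cx cy [] /einj E.
  by rewrite -(sec'P x cx) E sec'P.
have [|g gP] := Mhom _ Acard (d \o sec).
  move=> phi; rewrite -!(sat_rename sec) -cd sat_rename.
  by rewrite (_ : c \o sec = fun x => val x)//; apply/funext => x; exact: secP.
exists g => k.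
have ck : range c (c k) by exists k.
have := gP (SigSub (mem_set ck)); rewrite /= => ->.
have := secP (SigSub (mem_set ck)) => /= E.
by have /= := (cd (Eq (Var L (sec (SigSub (mem_set ck)))) (Var L k))).1 E.
Qed.

(** * Realizing partial types in many variables *)

Section realization.
Context (L : language).

Lemma exists_list (V : Type) (l : seq V) (phi : formula L V) :
  exists psi : formula L V, forall (M : structure L) (w : V -> M), sat w psi <->
    exists w' : V -> M, (forall x, ~ List.In x l -> w' x = w x) /\ sat w' phi.
Proof.
elim: l => [|x l [psi psiP]].
  exists phi => M w; split=> [wphi|[w' [w'w]]]; first by exists w.
  by rewrite (_ : w' = w)//; apply/funext => x; rewrite w'w.
exists (exists_var x psi) => M w; rewrite sat_exists_var; split.
  move=> [u [uw /psiP[w' [w'u w'phi]]]]; exists w'; split=> // y ny.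
  rewrite w'u ?uw//; first by move=> yx; apply: ny; left.
  by move=> yl; apply: ny; right.
move=> [w' [w'w w'phi]].
exists (fun y => if `[< y = x >] then w' x else w y); split.
  by move=> y yx; case: asboolP.
apply/psiP; exists w'; split=> // y yl; case: asboolP => [->//|yx].
by apply: w'w => -[/esym|].
Qed.

Context (M : structure L) (I V : Type) (e : V -> nat + I).
Hypotheses (Msat : succ_saturated M (nat + I)) (einj : injective e).
Context (c : nat -> M) (p : set (formula L (V + nat))).

Let extends (Gr : seq (V * M)) (a : V -> M) :=
  forall x, List.In x Gr -> a x.1 = x.2.

(* [Gr] is the graph of a partial tuple over which [p] is still finitely
   satisfiable; saturation extends it by one value and Zorn by all. *)
Let good (Gr : set (V * M)) := forall (q : set (formula L (V + nat))) gr,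
  finite_set q -> q `<=` p -> (forall x, List.In x gr -> Gr x) ->
  exists2 a, extends gr a & q `<=` [set phi | sat (assign a c) phi].

Let good_functional Gr v b b' : good Gr -> Gr (v, b) -> Gr (v, b') -> b = b'.
Proof.
move=> Gg vb vb'.
have [||//|a aP _] := Gg set0 [:: (v, b); (v, b')]; first exact: finite_set0.
- by move=> x [].
- by move=> x [<-|[<-|[]]].
have /= <- := aP (v, b) (or_introl erefl).
exact: (aP (v, b') (or_intror (or_introl erefl))).
Qed.

Section step.
Context (Gr : set (V * M)) (Gg : good Gr) (v : V).

Let A := [set b | (exists n, c n = b) \/ exists v', Gr (v', b)].

Let A_card : (A #<= [set: nat + I])%card.
Proof.
have /choice[cd cdP] : forall b, exists x : nat + V, A b ->
    match x with inl n => c n = b | inr v' => Gr (v', b) end.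
  move=> b; have [[[n cn]|[v' Gv']]|nA] := pselect (A b).
  - by exists (inl n).
  - by exists (inr v').
  - by exists (inl 0%N).
(* Even numbers code entries of [c]; odd numbers and elements of [I] code the variables given a
   value by [Gr]. *)
pose f (x : nat + V) : nat + I := match x with
  | inl n => inl n.*2
  | inr v' => match e v' with inl m => inl m.*2.+1 | inr i => inr i end end.
apply: (@card_le_inj _ _ _ (f \o cd)) => b b' Ab Ab' /=.
have := cdP b Ab; have := cdP b' Ab'.
case: (cd b) => [n|u]; case: (cd b') => [n'|u'] /=.
- by move=> <- <- [] /(congr1 half); rewrite !doubleK => ->.
- move=> _ _; case: (e u') => // m [] /(congr1 odd).
  by rewrite /= !odd_double.
- move=> _ _; case: (e u) => // m [] /(congr1 odd).
  by rewrite /= !odd_double.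
move=> Gu' Gu E.
have uu' : u = u'.
  apply: einj; move: E; case: (e u) => [m|i]; case: (e u') => [m'|i'] //.
  by move=> [] /(congr1 half); rewrite !doubleK => ->.
by rewrite uu' in Gu; exact: good_functional Gg Gu Gu'.
Qed.

Let aval (x : set_type A) : M := val x.

Let A_c n : A (c n). Proof. by left; exists n. Qed.
Let cA n : set_type A := SigSub (mem_set (A_c n)).

Let graph_formula (gr : seq (V * M)) : (forall x, List.In x gr -> Gr x) ->
  exists psi : formula L (V + set_type A), forall a : V -> M,
    sat (assign a aval) psi <-> extends gr a.
Proof.
elim: gr => [_|[w b] gr IH grG].
  by exists (Neg Bot) => a; split=> [_ x []|_ []].
have [|psi psiP] := IH; first by move=> x xgr; apply: grG; right.
have Ab : A b by right; exists w; apply: grG; left.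
pose b' : set_type A := SigSub (mem_set Ab).
exists (And (Eq (Var L (inl w)) (Var L (inr b'))) psi) => a.
rewrite sat_And psiP /=; split=> [[ab agr] x [<-//|/agr//]|agr].
split; first by apply: (agr (w, b)); left.
by move=> x xgr; apply: agr; right.
Qed.

(** All relevant variables other than [v] are quantified away, finitely many by finite support; a
    formula in one variable remains. *)
Let one_formula (q : set (formula L (V + nat))) gr : finite_set q ->
  (forall x, List.In x gr -> Gr x) ->
  exists chi : formula L (unit + set_type A), forall b : M,
    sat (assign (fun=> b) aval) chi <->
    exists a, [/\ a v = b, extends gr a & q `<=` [set phi | sat (assign a c) phi]].
Proof.
move=> qfin grG.
have [Phi PhiP] := finite_conj qfin; have [psi psiP] := graph_formula grG.
pose inA (x : V + nat) : V + set_type A :=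
  match x with inl w => inl w | inr n => inr (cA n) end.
pose Psi := And (rename inA Phi) psi.
have PsiP a : sat (assign a aval) Psi <->
    extends gr a /\ q `<=` [set phi | sat (assign a c) phi].
  rewrite sat_And psiP sat_rename (_ : _ \o _ = assign a c); last first.
    by apply/funext => -[].
  by rewrite PhiP; split=> -[].
have [s [/finite_set_list[S SP] sP]] := sat_support M Psi.
pose notv (x : V + set_type A) := if x is inl w then `[< w <> v >] else false.
pose l := List.filter notv S.
have [Xi XiP] := exists_list l Psi.
(* Collapsing all tuple variables to one is harmless, as those of the support other than [v] are
   quantified in [Xi]. *)
pose toU (x : V + set_type A) : unit + set_type A :=
  match x with inl w => inl tt | inr b => inr b end.
exists (rename toU Xi) => b.
rewrite sat_rename XiP; split.
  move=> [w' [w'off w'Psi]]; exists (w' \o inl).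
  have w'E : w' = assign (w' \o inl) aval.
    apply/funext => -[//|x] /=; rewrite w'off//= => /List.filter_In[_ //].
  rewrite w'E in w'Psi; have [gra qa] := (PsiP _).1 w'Psi.
  split=> //=; rewrite w'off//= => /List.filter_In[_ /=].
  by case: asboolP.
move=> [a [av agr aq]].
pose u := assign (fun _ : unit => b) aval \o toU.
exists (fun x => if `[< List.In x l >] then assign a aval x else u x).
split; first by move=> x xl; case: asboolP.
rewrite (sP _ (assign a aval)); first by apply/PsiP.
move=> x sx; case: asboolP => // nl.
case: x sx nl => [w|x] //= sw nl; rewrite /u /= -av; congr a.
apply: contrapT => wv; apply: nl; apply/List.filter_In; split; first exact/SP.
by apply/asboolP => wv'; apply: wv.
Qed.

(** The set [Sigma] collects what finitely many requirements force on the value at [v]; it is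
    finitely satisfiable because [Gr] is good. A realization [b] works, since by [one_formula] the
    existence of a suitable tuple with value [b] at [v] is itself expressed by a member of
    [Sigma]. *)
Lemma good_extension : exists b, good (Gr `|` [set (v, b)]).
Proof.
pose Sigma : set (formula L (unit + set_type A)) := [set chi | exists q gr,
  [/\ finite_set q, q `<=` p, forall x, List.In x gr -> Gr x &
    forall a, extends gr a -> q `<=` [set phi | sat (assign a c) phi] ->
      sat (assign (fun=> a v) aval) chi]].
have Sfin : finsat aval Sigma.
  move=> Q /finite_set_list[l lQ] QS.
  suff [q [gr [qfin qp grG H]]] : exists q gr,
      [/\ finite_set q, q `<=` p, forall x, List.In x gr -> Gr x &
      forall chi, List.In chi l -> forall a, extends gr a ->
      q `<=` [set phi | sat (assign a c) phi] ->
      sat (assign (fun=> a v) aval) chi].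
    have [a agr aq] := Gg qfin qp grG.
    by exists (fun=> a v) => chi /lQ /H; exact.
  have : forall chi, List.In chi l -> Sigma chi by move=> chi /lQ/QS.
  elim: l {lQ} => [_|chi l IH lS].
    exists set0, [::]; split=> //; exact: finite_set0.
  have [|q [gr [qfin qp grG H]]] := IH.
    by move=> x xl; apply: lS; right.
  have [q' [gr' [q'fin q'p gr'G H']]] := lS chi (or_introl erefl).
  exists (q `|` q'), (gr ++ gr'); split.
  - by rewrite finite_setU.
  - by move=> x [/qp|/q'p].
  - by move=> x /List.in_app_iff[/grG|/gr'G].
  move=> psi [<-|psil] a agr aq.
    apply: H'; last by move=> x xq; apply: aq; right.
    by move=> x xg; apply: agr; apply/List.in_app_iff; right.
  apply: H => //; last by move=> x xq; apply: aq; left.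
  by move=> x xg; apply: agr; apply/List.in_app_iff; left.
have [b bS] := Msat A_card Sfin.
exists b => q gr qfin qp grG.
have [gr0 [gr0G gr0P]] : exists gr0, (forall x, List.In x gr0 -> Gr x) /\
    forall x, List.In x gr -> List.In x gr0 \/ x = (v, b).
  elim: gr grG => [_|x gr IH grG]; first by exists [::].
  have [|gr0 [gr0G gr0P]] := IH; first by move=> z zg; apply: grG; right.
  have [Gx|xE] := grG x (or_introl erefl).
    exists (x :: gr0); split=> [z [<-//|/gr0G//]|z [<-|/gr0P[]]].
    - by left; left.
    - by left; right.
    - by right.
  by exists gr0; split=> // z [<-|/gr0P//]; right.
have [chi chiP] := one_formula qfin gr0G.
have /bS /chiP[a [av agr aq]] : Sigma chi.
  exists q, gr0; split=> // a agr aq; apply/chiP.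
  by exists a.
by exists a => // x /gr0P[/agr//|->].
Qed.

End step.

Lemma realize : finsat c p -> exists a, forall phi, p phi -> sat (assign a c) phi.
Proof.
move=> pfin.
have [Gr [Gg Gmax]] : exists Gr, good Gr /\ forall Gr', Gr `<` Gr' -> ~ good Gr'.
  apply: Zorn_bigcup => F Fgood Ftot q gr qfin qp grF.
  (* The first case covers the empty chain and rests on finite satisfiability of [p]. *)
  have [->|grX] : gr = [::] \/ exists2 X, F X & forall x, List.In x gr -> X x.
    elim: gr grF => [_|x gr IH grF]; first by left.
    right; have [X FX Xx] := grF x (or_introl erefl).
    have [|->|[X' FX' X'gr]] := IH; first by move=> z zg; apply: grF; right.
      by exists X => // z [<-|[]].
    have [XX'|X'X] := Ftot _ _ FX FX'.
      by exists X' => // z [<-|/X'gr//]; exact: XX'.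
    by exists X => // z [<-//|/X'gr/X'X].
  - by have [a aq] := pfin q qfin qp; exists a.
  - by have [X FX Xgr] := grX; exact: (Fgood X FX q gr).
have /choice[a aP] : forall v, exists b, Gr (v, b).
  move=> v; have [b bg] := good_extension Gg v; exists b.
  apply: contrapT => nGr; apply: (Gmax (Gr `|` [set (v, b)])) => //.
  split; first exact: subsetUl.
  by move=> /(_ (v, b)) H; apply: nGr; apply: H; right.
exists a => phi pphi.
have [s [/finite_set_list[S SP] sP]] := sat_support M phi.
pose gr := List.flat_map
  (fun x : V + nat => if x is inl v then [:: (v, a v)] else [::]) S.
have [|||a' a'gr a'q] := Gg [set phi] gr.
- exact: finite_set1.
- by move=> _ ->.
- move=> x /List.in_flat_map[[v|n] [_ /=]]; last by [].
  by move=> [<-|[]]; exact: aP.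
rewrite (sP _ (assign a' c)); first exact: a'q.
move=> [v|n] //= sv; rewrite (a'gr (v, a v))//.
apply/List.in_flat_map; exists (inl v); split; first exact/SP.
by left.
Qed.

End realization.

(** * An elementary pair of saturated models *)

Section elementary_pair.
Context (R : realType) (L : language) (C C' : structure L) (j : C -> C').
Context (I : Type) (pi : set (formula L I)).
Hypotheses (jel : elementary j) (Csat : succ_saturated C (nat + I))
  (Chom : succ_strongly_homogeneous C (nat + I))
  (C'hom : succ_strongly_homogeneous C' (nat + I)).
Local Notation S := (type_space C pi).
Local Notation S' := (type_space C' pi).
Local Notation phi := (type_flow C pi).
Local Notation phi' := (type_flow C' pi).
Local Notation r := (@type_restr L C C' j jel I pi).

(** Elementarity makes the type of [d'] over [j o al] finitely satisfiable in [C], and saturation of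
    [C] realizes it. The converse implication comes from negations. *)
Lemma reflect_tuple (d' : nat -> C') (al : nat -> C) : exists d : nat -> C,
  forall psi : formula L (nat + nat),
    sat (assign d al) psi <-> sat (assign d' (j \o al)) psi.
Proof.
pose p := [set psi : formula L (nat + nat) | sat (assign d' (j \o al)) psi].
have pfin : finsat al p.
  move=> q qfin qp; have [Phi PhiP] := finite_conj qfin.
  pose w := assign d' (j \o al).
  have wPhi : sat w Phi by apply/PhiP => psi /qp.
  have [s [sfin sP]] := sat_support C' Phi.
  have [m] := carrier_inhabited C.
  pose v : nat + nat -> C := assign (fun=> m) al.
  pose s' := s `&` range inl.
  pose w' x := if `[< s' x >] then w x else j (v x).
  have [|||u [uv uPhi]] := @sat_exists_vars _ _ _ j _ Phi v w' s' jel.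
  + exact: finite_setIl.
  + by move=> x sx; rewrite /w'; case: asboolP.
  + rewrite (sP w' w) // => x sx; rewrite /w'; case: asboolP => //.
    by case: x sx => [i|n] //= sx []; split => //; exists i.
  exists (u \o inl) => psi qpsi /=; move/PhiP: uPhi => /(_ _ qpsi) /=.
  congr (sat _ psi); apply/funext => -[//|n /=].
  by apply: uv => -[_ []].
have inlinj : injective (@inl nat I) by move=> x y [].
have [d dP] := realize Csat inlinj pfin.
exists d => psi; split; last exact: dP.
move=> dpsi; apply: contrapT => npsi.
by have /= := dP (Neg psi) npsi; exact.
Qed.

Lemma reflect_plain (d' : nat -> C') : exists d : nat -> C,
  forall psi : formula L nat, sat d psi <-> sat d' psi.
Proof.
have [m] := carrier_inhabited C.
have [d dP] := reflect_tuple d' (fun=> m).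
exists d => psi; have := dP (rename inl psi).
by rewrite !sat_rename.
Qed.

Definition solution := {a : I -> C | forall psi, pi psi -> sat a psi}.

Implicit Types z : solution.

Lemma solution_lift z psi : pi psi -> sat (j \o sval z) psi.
Proof. by move=> /(svalP z); rewrite (elementary_sat _ _ jel). Qed.

Lemma solution_act (g : aut C) z psi : pi psi -> sat (g \o sval z) psi.
Proof. by move=> /(svalP z); rewrite sat_aut. Qed.

Definition sol_act (g : aut C) z : solution :=
  exist _ (g \o sval z) (@solution_act g z).

Definition tp z : S := realized_type (svalP z).
Definition tp' z : S' := realized_type (@solution_lift z).

Lemma restr_tp' z : r (tp' z) = tp z.
Proof.
apply: type_space_eq => psi /=; rewrite sat_rename.
rewrite [X in _ <-> X](elementary_sat _ _ jel).
rewrite (_ : _ \o inr_map j = j \o assign (sval z) id)//.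
by apply/funext => -[].
Qed.

Lemma tp_act g z : phi g (tp z) = tp (sol_act g z).
Proof.
apply: type_space_eq => psi /=; rewrite sat_rename -(sat_aut g).
rewrite (_ : _ \o _ = assign (g \o sval z) id)//.
by apply/funext => -[//|x] /=; rewrite aut_invK.
Qed.

(** A basic neighbourhood involves finitely many parameters; saturation realizes the part of [p]
    over them, which includes [pi]. *)
Lemma tp_dense (p : S) : closure (range tp) p.
Proof.
move=> A /nbhs_type[s [sp sA]].
have [d JdP] : exists d : nat -> C, forall psi, psi \in s ->
    exists psi' : formula L (I + nat), psi = rename (inr_map d) psi'.
  have [l lP] := finite_set_list (finite_fset s).
  have [J [d JdP]] := extract_parameters l (carrier_inhabited C).
  by exists d => psi /lP /JdP[psi' ? _]; exists psi'.
pose Sig := [set psi : formula L (I + nat) | p (rename (inr_map d) psi)].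
have Sfin : finsat d Sig.
  move=> q qfin qS.
  have [||a aP] := @type_finsat _ _ _ _ p (rename (inr_map d) @` q).
  - exact: finite_image.
  - by move=> _ [psi /qS ? <-].
  exists a => psi qpsi.
  have := aP (rename (inr_map d) psi); rewrite /= sat_rename => H.
  rewrite (_ : assign a d = assign a id \o inr_map d); first by apply: H; exists psi.
  by apply/funext => -[].
have inrinj : injective (@inr nat I) by move=> x y [].
have [a aP] := realize Csat inrinj Sfin.
have api psi : pi psi -> sat a psi.
  move=> pipsi; have := aP (rename inl psi); rewrite sat_rename; apply.
  by rewrite /Sig /= rename_comp; exact: type_extends.
exists (tp (exist _ a api)); split; first by exists (exist _ a api).
apply: sA => psi psis; have [psi' psiE] := JdP psi psis.
rewrite psiE; apply/realized_typeE; apply: aP.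
by rewrite /Sig /= -psiE; exact: sp.
Qed.

Lemma solution_entries (s : seq solution) (J : seq I) : exists al : nat -> C,
  forall z, List.In z s -> exists idx : I -> nat,
    forall i, List.In i J -> al (idx i) = sval z i.
Proof.
pose l := List.flat_map (fun z => List.map (sval z) J) s.
have [al alP] := list_enum l (carrier_inhabited C).
exists al => z zs; have /choice[idx idxP] : forall i, exists n,
    List.In i J -> al n = sval z i.
  move=> i; have [iJ|niJ] := pselect (List.In i J); last by exists 0%N.
  have [|n nE] := alP (sval z i); last by exists n.
  apply/List.in_flat_map; exists z; split=> //.
  by apply/List.in_map_iff; exists i.
by exists idx.
Qed.

Definition nn_code (x : nat + nat) : nat :=
  match x with inl n => n.*2 | inr n => n.*2.+1 end.

Lemma nn_code_inj : injective nn_code.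
Proof.
move=> [n|n] [m|m] /= E.
- by rewrite -(doubleK n) E doubleK.
- by move/(congr1 odd): E; rewrite /= !odd_double.
- by move/(congr1 odd): E; rewrite /= !odd_double.
- by case: E => E; rewrite -(doubleK n) E doubleK.
Qed.

(** Up to [e], [f] depends on the parameters [d'] only. These have a copy [d] in [C] over the
    relevant entries [al]. An automorphism taking [d'] to [j o d] and fixing [j o al] nearly
    preserves the values at the types from [s], and brings the parameters into [C], where
    restrictions decide. *)
Lemma stabilize (f : S' -> R) (s : seq solution) (e : R) : continuous f -> 0 < e ->
  exists g' : aut C',
    (forall z, List.In z s -> `|f (phi' g'^-1%g (tp' z)) - f (tp' z)| < e) /\
    forall p' q', r p' = r q' ->
      `|f (phi' g'^-1%g p') - f (phi' g'^-1%g q')| < e.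
Proof.
move=> fc e0; have [J [d' Jd']] := variable_determination fc e0.
have [al alP] := solution_entries s J.
have [d dP] := reflect_tuple d' al.
have [|g gP] := @tuple_homogeneous _ _ I _ nn_code (assign d' (j \o al))
    (assign (j \o d) (j \o al)) C'hom nn_code_inj.
  move=> psi; rewrite -dP (elementary_sat _ _ jel).
  rewrite (_ : j \o assign d al = assign (j \o d) (j \o al))//.
  by apply/funext => -[].
have gd : g \o d' = j \o d by apply/funext => n; exact: (gP (inl n)).
have gal n : g (j (al n)) = j (al n) by exact: (gP (inr n)).
exists g; split=> [z zs|p' q' pq]; apply: Jd' => psi psiJ.
  rewrite type_actVE gd !realized_typeE -[X in _ <-> X](sat_aut g).
  rewrite (_ : g \o assign (j \o sval z) d' =
    assign (g \o (j \o sval z)) (j \o d)); last first.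
    by rewrite -gd; apply/funext => -[].
  apply: sat_var_support psiJ _ => i iJ /=.
  by have [idx idxP] := alP z zs; rewrite -idxP// gal.
by rewrite !type_actVE gd -!(type_restrE jel) pq.
Qed.

(** The relevant entries of the tuples and their images under [g^-1] have the same type in [C'], so
    some [g'] takes the images back to the entries. *)
Lemma imitate (f : S' -> R) (g : aut C) (s : seq solution) (e : R) :
  continuous f -> 0 < e -> exists g' : aut C', forall z, List.In z s ->
    `|f (phi' g'^-1%g (tp' z)) - f (tp' (sol_act g^-1%g z))| < e.
Proof.
move=> fc e0; have [J [d' Jd']] := variable_determination fc e0.
have [al alP] := solution_entries s J.
have [|g' gP] := @tuple_homogeneous _ _ I _ id (j \o ((g^-1)%g \o al))
    (j \o al) C'hom (fun _ _ => id).
  by move=> psi; rewrite -!(elementary_sat _ _ jel) sat_aut.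
exists g' => z zs; apply: Jd' => psi psiJ.
rewrite type_actVE !realized_typeE -[X in _ <-> X](sat_aut g').
rewrite (_ : g' \o assign (j \o sval (sol_act g^-1%g z)) d' =
  assign (g' \o (j \o ((g^-1)%g \o sval z))) (g' \o d')); last first.
  by apply/funext => -[].
apply: sat_var_support psiJ _ => i iJ /=.
by have [idx idxP] := alP z zs; rewrite -idxP//; exact/esym/(gP (idx i)).
Qed.

(** The parameters [c] of [f], moved back by [s'], are copied into [C] over the entries [al], and
    [g] takes [c] to this copy. *)
Lemma pull_back (f : S -> R) (s' : aut C') (s : seq solution) (e : R) :
  continuous f -> 0 < e -> exists g : aut C, forall z, List.In z s ->
    `|f (phi g^-1%g (tp z)) - f (r (phi' s' (tp' z)))| < e.
Proof.
move=> fc e0; have [J [c Jc]] := variable_determination fc e0.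
have [al alP] := solution_entries s J.
pose d' := aut_inv s' \o (j \o c).
have [d dP] := reflect_tuple d' al.
have [|g gP] := @tuple_homogeneous _ _ I _ id c d Chom (fun _ _ => id).
  move=> psi; have := dP (rename inl psi); rewrite !sat_rename.
  rewrite -[assign d al \o inl]/d -[assign d' _ \o inl]/d' => ->.
  rewrite (elementary_sat _ _ jel) -[X in _ <-> X](sat_aut s').
  rewrite (_ : s' \o d' = j \o c)//.
  by apply/funext => n; rewrite /d' /= aut_invK.
have gc : g \o c = d by apply/funext => n; exact: gP.
exists g => z zs; apply: Jc => psi psiJ.
rewrite type_actVE gc type_restrE type_actE !realized_typeE.
have [idx idxP] := alP z zs.
pose sw (x : I + nat) : nat + nat :=
  match x with inl i => inr (idx i) | inr n => inl n end.
have := dP (rename sw psi); rewrite !sat_rename.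
rewrite (_ : assign d al \o sw = assign (al \o idx) d); last first.
  by apply/funext => -[].
rewrite (_ : assign d' (j \o al) \o sw = assign (j \o al \o idx) d'); last first.
  by apply/funext => -[].
rewrite (sat_var_support (b := sval z) _ psiJ) => [->|//].
by apply: sat_var_support psiJ _ => i iJ /=; rewrite idxP.
Qed.

Lemma restr_surj (p : S) : exists p', r p' = p.
Proof.
have [p' _ <-] := closed_lift (@type_space_hausdorff _ _ _ _)
  (@type_space_compact _ _ _ _) (@type_restr_continuous _ _ _ _ jel I pi)
  restr_tp' (@tp_dense) p.
by exists p'.
Qed.

(** The automorphism [s'] takes the countably many parameters of [f'] to a tuple [j o c]. For a
    sequence [t'], the preimages of [j o c] under all [t' n] form one countable tuple [d'] with a
    copy [d] in [C]. Then [rho] comes from taking [d'] to [j o d], and [t n] from taking [c] to the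
    part of [d] with index [n]. *)
Lemma small_support (f' : S' -> R) : continuous f' ->
  exists (s' : aut C') (f : S -> R), (forall p', f' p' = f (r (phi' s' p'))) /\
    forall t' : nat -> aut C', exists (t : nat -> aut C) (rho : S' -> S'),
    forall n p', f (r (phi' (t' n) p')) = f (phi (t n)^-1%g (r (rho p'))).
Proof.
move=> f'c; have [c' c'P] := countable_determination f'c.
have [c cc'] := reflect_plain c'.
have [|s' sP] := @tuple_homogeneous _ _ I _ id c' (j \o c) C'hom (fun _ _ => id).
  by move=> psi; rewrite -(elementary_sat _ _ jel) cc'.
have sc' : s' \o c' = j \o c by apply/funext => n; exact: sP.
have s'c : aut_inv s' \o (j \o c) = c'.
  by rewrite -sc'; apply/funext => n /=; rewrite aut_funK.
have /choice[up upr] := restr_surj.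
pose f p := f' (phi' s'^-1%g (up p)).
have fP (p q : S) : (forall psi : formula L (I + nat),
    p (rename (inr_map c) psi) <-> q (rename (inr_map c) psi)) -> f p = f q.
  move=> pq; apply: c'P => psi; rewrite !type_actVE sc'.
  by rewrite -!(type_restrE jel) !upr.
exists s', f; split=> [p'|t'].
  apply: c'P => psi; rewrite type_actVE sc' -(type_restrE jel) upr type_restrE.
  by rewrite type_actE s'c.
pose pk (n m : nat) := choice.pickle (n, m).
pose d' (k : nat) : C' :=
  if (choice.unpickle k : option (nat * nat)) is Some (n, m)
  then aut_inv (t' n) (j (c m)) else j (c 0%N).
have d'pk n : d' \o pk n = aut_inv (t' n) \o (j \o c).
  by apply/funext => m; rewrite /d' /pk /= choice.pickleK.
have [d dd'] := reflect_plain d'.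
have [|rho rhoP] := @tuple_homogeneous _ _ I _ id d' (j \o d) C'hom (fun _ _ => id).
  by move=> psi; rewrite -(elementary_sat _ _ jel) dd'.
have rhod : aut_inv rho \o (j \o d) = d'.
  by apply/funext => k /=; rewrite -[j (d k)]/((j \o d) k) -rhoP aut_funK.
have /choice[t tP] : forall n, exists t : aut C, forall m, t (c m) = d (pk n m).
  move=> n; apply: (@tuple_homogeneous _ _ I _ id c (d \o pk n)) => // psi.
  rewrite -sat_rename dd' sat_rename d'pk -[X in _ <-> X](sat_aut (t' n)).
  rewrite (elementary_sat _ _ jel) (_ : t' n \o _ = j \o c)//.
  by apply/funext => m /=; rewrite aut_invK.
exists t, (phi' rho) => n p'; apply: fP => psi.
rewrite type_restrE type_actE type_actVE type_restrE type_actE.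
rewrite (_ : aut_inv rho \o _ = d' \o pk n); first by rewrite d'pk.
rewrite -rhod; apply/funext => m /=; by rewrite tP.
Qed.

End elementary_pair.

Theorem theorem6p27 (R : realType) (L : language) (T : set (sentence L))
    (C C' : structure L) (j : C -> C')
    (I : Type) (pi : set (formula L I)) (X : set (I -> C))
    (F : equiv_rel (type_space C pi)) (F' : equiv_rel (type_space C' pi))
    (T_complete : complete_theory T) (C_model : models C T)
    (C'_model : models C' T) (j_elem : elementary j)
    (C_sat : succ_saturated C (nat + I))
    (C'_sat : succ_saturated C' (nat + I))
    (C_hom : succ_strongly_homogeneous C (nat + I))
    (C'_hom : succ_strongly_homogeneous C' (nat + I))
    (X_def : type_defines pi X)
    (F_WAP : is_F_WAP R (type_flow C pi) F)
    (F'_WAP : is_F_WAP R (type_flow C' pi) F') :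
  [set (type_restr j_elem ab.1, type_restr j_elem ab.2)
     | ab in [set ab | F' ab.1 ab.2]]
  = [set ab | F ab.1 ab.2].
Proof.
have Sc := @type_space_compact L C I pi.
have S'c := @type_space_compact L C' I pi.
have Sh := @type_space_hausdorff L C I pi.
have S'h := @type_space_hausdorff L C' I pi.
have rc := @type_restr_continuous L C C' j j_elem I pi.
apply/seteqP; split=> [_ [[p' q'] /= pq <-]|[p q] /= pq].
  apply: (F_WAP_restrict (R := R) Sc Sh S'c rc (restr_tp' j_elem)
    (@tp_dense _ _ _ _ C_sat)) F_WAP.1 _ F'_WAP _ _ pq.
    move=> f s' s e fc e0; exact: pull_back.
  move=> f' f'c; exact: small_support.
have [||p' [q' [pq' <- <-]]] := @F_WAP_lift R _ _ _ _ (type_flow C pi)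
    (type_flow C' pi) _ _ _ _ (@sol_act _ C I pi) Sc Sh S'c S'h rc (restr_tp' j_elem)
    (@tp_dense _ _ _ _ C_sat) (@tp_act _ _ _ _) F F' _ _ F_WAP F'_WAP.1 p q pq.
- move=> f s e fc e0; exact: stabilize.
- move=> f g s e fc e0; exact: imitate.
by exists (p', q').
Qed.
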